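(* There exists an algorithm which, given as input a finite set $L$ of finite graphs, decides whether the class $\mathrm{Free}(L)$ contains infinitely many pairwise non-isomorphic prime graphs.
   Context: All graphs are finite and simple. $H$ is an induced subgraph of $G$ (up to isomorphism) if $H$ is isomorphic to a graph obtained from $G$ by deleting some vertices. For a set $X$ of graphs, a graph $G$ is $X$-free if no graph in $X$ is isomorphic to an induced subgraph of $G$, and $\mathrm{Free}(X)$ denotes the class of all $X$-free graphs. A homogeneous set of a graph $G$ is a set $X\subseteq V(G)$ with $2\le |X|<|V(G)|$ such that every vertex of $V(G)\setminus X$ is either adjacent to all vertices of $X$ or adjacent to none of them. A graph is prime if it has no homogeneous set. *)

(* Defs.v *)
From Stdlib Require List.
From mathcomp Require Import all_boot.
Set Implicit Arguments.
Unset Strict Implicit.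
Unset Printing Implicit Defensive.

(** The graph with no vertices is allowed. *)

Record sgraph := SGraph {
  vertex :> finType;
  edge : rel vertex;
  edge_sym : symmetric edge;
  edge_irrefl : irreflexive edge }.

Definition iso (G H : sgraph) : Prop :=
  exists2 f : G -> H, bijective f &
    forall x y : G, edge (f x) (f y) = edge x y.

Section Restriction.
Variables (G : sgraph) (S : {set G}).

Definition restr_edge : rel {x : G | x \in S} :=
  fun x y => edge (val x) (val y).

Lemma restr_edge_sym : symmetric restr_edge.
Proof. by move=> x y; apply: edge_sym. Qed.

Lemma restr_edge_irrefl : irreflexive restr_edge.
Proof. by move=> x; apply: edge_irrefl. Qed.

(* The graph obtained from G by deleting the vertices outside S. *)
Definition restr : sgraph := SGraph restr_edge_sym restr_edge_irrefl.
End Restriction.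

Definition induced_subgraph (H G : sgraph) : Prop :=
  exists S : {set G}, iso H (restr S).

Definition Free (X : sgraph -> Prop) (G : sgraph) : Prop :=
  forall H : sgraph, X H -> ~ induced_subgraph H G.

Definition homogeneous (G : sgraph) (X : {set G}) : Prop :=
  2 <= #|X| < #|G| /\
  forall v : G, v \notin X ->
    (forall x, x \in X -> edge v x) \/ (forall x, x \in X -> ~~ edge v x).

Definition prime_graph (G : sgraph) : Prop :=
  ~ exists X : {set G}, homogeneous X.

Definition infinitely_many_up_to_iso (C : sgraph -> Prop) : Prop :=
  exists F : nat -> sgraph,
    (forall i, C (F i)) /\ (forall i j, i <> j -> ~ iso (F i) (F j)).

(** Algorithms are represented by partial recursive (mu-recursive) functions.
    A term of type [recfun n] is a program with n natural-number arguments. *)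

Inductive recfun : nat -> Type :=
| RZero n : recfun n
| RSucc : recfun 1
| RProj n : 'I_n -> recfun n
| RComp m n : recfun m -> ('I_m -> recfun n) -> recfun n
| RPrec n : recfun n -> recfun n.+2 -> recfun n.+1
| RMin n : recfun n.+1 -> recfun n.

(* [computes p v y]: on arguments v, p halts with value y. For [RPrec f g] the
   recursion is on the first argument, with
     h(0, v) = f(v)   and   h(k+1, v) = g(k, h(k, v), v).
   [RMin f] searches for the least y with f(y, v) = 0, and every f(z, v) with
   z < y has to be defined. *)
Fixpoint computes n (p : recfun n) : n.-tuple nat -> nat -> Prop :=
  match p in recfun n return n.-tuple nat -> nat -> Prop with
  | RZero _ => fun _ y => y = 0
  | RSucc => fun v y => y = (thead v).+1
  | RProj _ i => fun v y => y = tnth v i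
  | RComp m _ f g => fun v y =>
      exists2 w : m.-tuple nat,
        forall i, computes (g i) v (tnth w i) & computes f w y
  | RPrec n f g => fun v =>
      let v' : n.-tuple nat := behead_tuple v in
      (fix prec (k : nat) : nat -> Prop :=
         match k with
         | 0 => computes f v'
         | k'.+1 => fun y =>
             exists2 z, prec k' z & computes g (cons_tuple k' (cons_tuple z v')) y
         end) (thead v)
  | RMin _ f => fun v y =>
      computes f (cons_tuple y v) 0 /\
      forall z, z < y -> exists u, computes f (cons_tuple z v) u.+1
  end.

Lemma computes_functional n (p : recfun n) v y1 y2 :
  computes p v y1 -> computes p v y2 -> y1 = y2.
Proof.
elim: p v y1 y2 => {n} [n|| n i | m n f IHf g IHg | n f IHf g IHg | n f IHf]
  v y1 y2 /=; try by move=> -> ->.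
- move=> [w1 Hw1 H1] [w2 Hw2 H2].
  suff E : w1 = w2 by rewrite E in H1; apply: IHf H1 H2.
  by apply: eq_from_tnth => i; apply: IHg (Hw1 i) (Hw2 i).
- elim: (thead v) y1 y2 => [|k IHk] y1 y2; first exact: IHf.
  by move=> [z1 /IHk Hz H1] [z2 /Hz Ez H2]; rewrite Ez in H1; apply: IHg H1 H2.
- move=> [H1 L1] [H2 L2]; case: (ltngtP y1 y2) => // [/L2|/L1] [u Hu].
  + by have := IHf _ _ _ H1 Hu.
  + by have := IHf _ _ _ H2 Hu.
Qed.

(** A graph is given by its number of vertices and its adjacency matrix
    (row by row, relative to the enumeration of its vertex type), a finite set
    of graphs by a list. [CodeSeq.code] is a bijection from [seq nat] to [nat]. *)

Definition encode_graph (G : sgraph) : nat :=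
  CodeSeq.code
    (#|G| :: [seq nat_of_bool (edge x y) | x <- enum G, y <- enum G]).

Definition encode_graphs (L : seq sgraph) : nat :=
  CodeSeq.code [seq encode_graph G | G <- L].

(* [p] halts on every input, with value 1 if P holds and value 0 otherwise. *)
Definition decides (p : recfun 1) (P : seq sgraph -> Prop) : Prop :=
  forall L : seq sgraph,
    exists2 b : bool, computes p [tuple encode_graphs L] b & (b <-> P L).

(* Main.v *)
Require Import Defs.
From Stdlib Require List.
From mathcomp Require Import all_boot.
From mathcomp Require Import zify.
From Stdlib Require Import IndefiniteDescription.
Set Implicit Arguments.
Unset Strict Implicit.
Unset Printing Implicit Defensive.

(** A word over a finite alphabet defines a graph on its positions, in which the adjacency of
    i < j depends on the letters at i and j and on whether j = i + 1. Following Chudnovsky, Kim,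
    Oum and Seymour, every large prime graph contains a long word graph of one of finitely many
    kinds: a chain (each vertex has its predecessor as unique neighbour or as unique
    non-neighbour among the earlier vertices) or a member of one of finitely many families with
    a periodic word (spiders, half-graphs, ...) or of their complements. Conversely, long words
    of each kind contain large prime graphs. Hence Free(L) contains infinitely many prime graphs
    iff for some kind there are arbitrarily long L-free words.

    Whether a word graph contains a given graph is recognised by a finite automaton. So, by
    pumping, arbitrarily long L-free words exist as soon as one exists whose length exceeds a
    bound computable from L, and such a word can be searched for exhaustively.

    For the unavoidability theorem, let G be prime without long chain. Then from any pair of
    vertices every other vertex is reached by few steps, each adding a vertex that distinguishes
    two of the previous ones. By Ramsey, G or its complement has a large stable set, and its
    vertices have distinct neighbourhoods; Ramsey again yields a member of a family, an induced
    matching or a threshold graph. In the last two cases, following the steps from the edges of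
    the matching to a common vertex, or from the end of the threshold graph to its beginning,
    produces a member of a family. *)

(** * Programs *)

(* [k.2] is the first argument of a program run in the context [k], and [k.1] holds the others. *)
Fixpoint ctx (n : nat) : Type := if n is n'.+1 then (ctx n' * nat)%type else unit.

Fixpoint tup n : ctx n -> n.-tuple nat :=
  if n is n'.+1 return ctx n -> n.-tuple nat
  then fun k => cons_tuple k.2 (tup k.1) else fun=> [tuple].

Definition computable n (f : ctx n -> nat) :=
  exists p : recfun n, forall k, computes p (tup k) (f k).

Definition decidable_in n (P : ctx n -> bool) := computable (fun k => P k : nat).

Lemma computable_ext n (f g : ctx n -> nat) : f =1 g -> computable f -> computable g.
Proof. by move=> e [p hp]; exists p => k; rewrite -e. Qed.

Lemma computable_comp m n (f : ctx m -> nat) (g : ctx n -> ctx m) :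
  computable f -> (forall i : 'I_m, computable (fun k => tnth (tup (g k)) i)) ->
  computable (fun k => f (g k)).
Proof.
move=> [p hp] /fin_all_exists[q hq]; exists (RComp p q) => k /=.
by exists (tup (g k)) => // i; apply: hq.
Qed.

Lemma computable1 (F : nat -> nat) n f :
  computable (fun q : ctx 1 => F q.2) -> computable f ->
  computable (fun k : ctx n => F (f k)).
Proof.
move=> hF hf; apply: (@computable_comp 1 n (fun q => F q.2) (fun k => (tt, f k))) => //.
by case=> [[|//] hi]; apply: computable_ext hf => k; rewrite (tnth_nth 0).
Qed.

Lemma computable_snd n : computable (fun k : ctx n.+1 => k.2).
Proof. by exists (RProj ord0) => k /=; rewrite (tnth_nth 0). Qed.

Lemma computable_fst n (f : ctx n -> nat) :
  computable f -> computable (fun k : ctx n.+1 => f k.1).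
Proof.
move=> hf; apply: (@computable_comp n n.+1 f fst) => // i.
by exists (RProj (lift ord0 i)) => k /=; rewrite !(tnth_nth 0).
Qed.

Ltac computable_var :=
  solve [ exact: computable_snd | exact: (computable_fst (computable_snd _))
        | exact: (computable_fst (computable_fst (computable_snd _)))
        | exact: (computable_fst (computable_fst (computable_fst (computable_snd _)))) ].

Lemma computable_succ n f : computable f -> computable (fun k : ctx n => (f k).+1).
Proof. by apply: computable1; exists RSucc. Qed.

Lemma computable_cst n c : computable (fun _ : ctx n => c).
Proof. by elim: c => [|c]; [exists (RZero n) | apply: computable_succ]. Qed.

(** [RPrec] hands its step the counter, the accumulator and the old arguments in this order, whence
    the shape of the context of [s]. The bound is first an extra first argument, for which [c k] is
    then substituted. *)
Lemma computable_iteri n c (s : ctx n -> nat -> nat -> nat) b :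
  computable c -> computable (fun q : ctx n.+2 => s q.1.1 q.2 q.1.2) ->
  computable b -> computable (fun k => iteri (c k) (s k) (b k)).
Proof.
move=> hc [ps hs] [pb hb].
apply: (@computable_comp n.+1 n (fun q => iteri q.2 (s q.1) (b q.1))
          (fun k => (k, c k))); last first.
  case: (fin_all_exists (fun i : 'I_n =>
    ex_intro (fun p => forall k : ctx n, computes p (tup k) (tnth (tup k) i))
      (RProj i) (fun k => erefl _))) => q hq i.
  case: (unliftP ord0 i) => [j|] ->.
    by exists (RProj j) => k /=; rewrite !(tnth_nth 0).
  by apply: computable_ext hc => k; rewrite (tnth_nth 0).
exists (RPrec pb ps) => -[k c0] /=.
have -> : behead_tuple (cons_tuple c0 (tup k)) = tup k by apply: val_inj.
rewrite theadE; elim: c0 => [|c0 ih]; first exact: hb.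
by exists (iteri c0 (s k) (b k)) => //; apply: (hs ((k, iteri c0 (s k) (b k)), c0)).
Qed.

Lemma computable_mu n (P : ctx n -> nat -> bool) f :
  decidable_in (fun q : ctx n.+1 => P q.1 q.2) ->
  (forall k, P k (f k)) -> (forall k y, P k y -> f k <= y) -> computable f.
Proof.
move=> hP Pf fmin.
(* [RMin] looks for a zero, so the test is negated: this iteration has value 0 if [P] holds and 1
   otherwise. *)
have [p hp] : computable (fun q : ctx n.+1 =>
    iteri (P q.1 q.2) (fun _ _ => 0) 1).
  by apply: computable_iteri => //; apply: computable_cst.
exists (RMin p) => k /=; split; first by have := hp (k, f k); rewrite /= Pf.
move=> z lt; exists 0; have := hp (k, z) => /=.
by case: (boolP (P k z)) => [/fmin|//]; rewrite leqNgt lt.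
Qed.

Lemma computable_add n f g : computable f -> computable g ->
  computable (fun k : ctx n => f k + g k).
Proof.
move=> hf hg; apply: (@computable_ext _ (fun k => iteri (f k) (fun _ => succn) (g k))).
  by move=> k; elim: (f k) => //= m ->; rewrite addSn.
apply: computable_iteri => //; apply: computable_succ.
by computable_var.
Qed.

Lemma computable_mul n f g : computable f -> computable g ->
  computable (fun k : ctx n => f k * g k).
Proof.
move=> hf hg; apply: (@computable_ext _ (fun k => iteri (f k) (fun _ a => a + g k) 0)).
  by move=> k; elim: (f k) => //= m ->; rewrite mulSn addnC.
apply: computable_iteri => //; last exact: computable_cst.
apply: computable_add; first by computable_var.
exact: (computable_fst (computable_fst hg)).
Qed.

Lemma computable_exp2 n f : computable f -> computable (fun k : ctx n => 2 ^ f k).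
Proof.
move=> hf; apply: (@computable_ext _ (fun k => iteri (f k) (fun _ a => a + a) 1)).
  by move=> k; elim: (f k) => //= m ->; rewrite expnS mul2n addnn.
apply: computable_iteri => //; last exact: computable_cst.
by apply: computable_add; computable_var.
Qed.

Lemma computable_sub n f g : computable f -> computable g ->
  computable (fun k : ctx n => f k - g k).
Proof.
have hpred m h : computable h -> computable (fun k : ctx m => (h k).-1).
  move=> hh; apply: (@computable_ext _ (fun k => iteri (h k) (fun i _ => i) 0)).
    by move=> k; case: (h k).
  by apply: computable_iteri => //; [computable_var | exact: computable_cst].
move=> hf hg; apply: (@computable_ext _ (fun k => iteri (g k) (fun _ a => a.-1) (f k))).
  by move=> k; elim: (g k) => [|m /= ->]; rewrite ?subn0 ?subnS.
apply: computable_iteri => //; apply: hpred.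
by computable_var.
Qed.

Lemma decidable_not n P : decidable_in P -> decidable_in (fun k : ctx n => ~~ P k).
Proof.
move=> hP; apply: (@computable_ext _ (fun k => 1 - P k)); first by move=> k; case: (P k).
by apply: computable_sub => //; apply: computable_cst.
Qed.

Lemma decidable_and n P Q : decidable_in P -> decidable_in Q ->
  decidable_in (fun k : ctx n => P k && Q k).
Proof.
move=> hP hQ; apply: (@computable_ext _ (fun k => P k * Q k)); last exact: computable_mul.
by move=> k; rewrite mulnb.
Qed.

Lemma decidable_or n P Q : decidable_in P -> decidable_in Q ->
  decidable_in (fun k : ctx n => P k || Q k).
Proof.
move=> hP hQ; apply: (@computable_ext _ (fun k => ~~ (~~ P k && ~~ Q k))).
  by move=> k; rewrite negb_and !negbK.
by apply: decidable_not; apply: decidable_and; apply: decidable_not.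
Qed.

Lemma decidable_leq n f g : computable f -> computable g ->
  decidable_in (fun k : ctx n => f k <= g k).
Proof.
move=> hf hg; apply: (@computable_ext _ (fun k => 1 - (f k - g k))).
  by move=> k; rewrite /leq; case: (f k - g k).
apply: computable_sub; [exact: computable_cst | exact: computable_sub].
Qed.

Lemma decidable_eqn n f g : computable f -> computable g ->
  decidable_in (fun k : ctx n => f k == g k).
Proof.
move=> hf hg; apply: (@computable_ext _ (fun k => (f k <= g k) && (g k <= f k))).
  by move=> k; rewrite eqn_leq.
by apply: decidable_and; apply: decidable_leq.
Qed.

Lemma decidable_eqb n P Q : decidable_in P -> decidable_in Q ->
  decidable_in (fun k : ctx n => P k == Q k).
Proof.
move=> hP hQ; apply: (computable_ext _ (decidable_eqn hP hQ)) => k.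
by case: (P k); case: (Q k).
Qed.

Lemma decidable_if n (C P Q : ctx n -> bool) :
  decidable_in C -> decidable_in P -> decidable_in Q ->
  decidable_in (fun k => if C k then P k else Q k).
Proof.
move=> hC hP hQ; apply: (@computable_ext _ (fun k => C k && P k || ~~ C k && Q k)).
  by move=> k; case: (C k) => //=; rewrite orbF.
by apply: decidable_or; apply: decidable_and => //; apply: decidable_not.
Qed.

Lemma decidable_all n (P : ctx n -> nat -> bool) b :
  computable b -> decidable_in (fun q : ctx n.+1 => P q.1 q.2) ->
  decidable_in (fun k => all (P k) (iota 0 (b k))).
Proof.
move=> hb hP; apply: (@computable_ext _ (fun k =>
  iteri (b k) (fun i a => a * P k i) 1)).
  move=> k; elim: (b k) => // m ih.
  by rewrite -addn1 iotaD all_cat /= add0n andbT addn1 /= ih mulnb.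
apply: computable_iteri => //; last exact: computable_cst.
apply: computable_mul; first by computable_var.
apply: (@computable_comp n.+1 n.+2 (fun q => P q.1 q.2) (fun q => (q.1.1, q.2))) => // i.
case: (unliftP ord0 i) => [j|] ->.
  by exists (RProj (lift ord0 (lift ord0 j))) => k /=; rewrite !(tnth_nth 0).
by exists (RProj ord0) => k /=; rewrite !(tnth_nth 0).
Qed.

Lemma decidable_has n (P : ctx n -> nat -> bool) b :
  computable b -> decidable_in (fun q : ctx n.+1 => P q.1 q.2) ->
  decidable_in (fun k => has (P k) (iota 0 (b k))).
Proof.
move=> hb hP; apply: (@computable_ext _ (fun k =>
  ~~ all (fun i => ~~ P k i) (iota 0 (b k)))).
  by move=> k; rewrite all_predC negbK.
by apply: decidable_not; apply: decidable_all => //; apply: decidable_not.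
Qed.

Lemma decidable_mem2 n f g (s : seq (nat * nat)) : computable f -> computable g ->
  decidable_in (fun k : ctx n => (f k, g k) \in s).
Proof.
move=> hf hg; elim: s => [|[a b] s ih]; first exact: computable_cst.
apply: (@computable_ext _ (fun k => ((f k == a) && (g k == b)) || ((f k, g k) \in s))).
  by move=> k; rewrite in_cons xpair_eqE.
apply: decidable_or => //.
by apply: decidable_and; apply: decidable_eqn => //; apply: computable_cst.
Qed.

(** * Lists coded as numbers *)

Definition hdc m := head 0 (CodeSeq.decode m).
Definition tlc m := CodeSeq.code (behead (CodeSeq.decode m)).

Lemma code_cons x s :
  CodeSeq.code (x :: s) = 2 ^ x * (CodeSeq.code s).*2.+1.
Proof. by []. Qed.

(** A nonzero code is [2 ^ x * (2 * z + 1)] with [x] the head and [z] the code of the tail, so [x]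
    is found by a search with [z] bounded by the code. On 0, the code of the empty list, the search
    stops at the default head 0. *)
Lemma computable_hdc n f : computable f -> computable (fun k : ctx n => hdc (f k)).
Proof.
apply: computable1.
apply: (@computable_mu 1 (fun q y => (q.2 == 0) ||
  has (fun z => q.2 == 2 ^ y * (z + z).+1) (iota 0 (q.2 + 1)))) => /=.
- apply: decidable_or; first by apply: decidable_eqn; [computable_var | exact: computable_cst].
  apply: decidable_has.
    by apply: computable_add; [computable_var | exact: computable_cst].
  apply: decidable_eqn; first by computable_var.
  apply: computable_mul; first by apply: computable_exp2; computable_var.
  by apply/computable_succ/computable_add; computable_var.
- move=> [_ m] /=; rewrite /hdc; case E: (CodeSeq.decode m) (CodeSeq.decodeK m) => [|y s] /=.
    by move=> <-.
  rewrite -/(CodeSeq.code s) => Em; apply/orP; right; apply/hasP; exists (CodeSeq.code s).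
    by rewrite mem_iota /= add0n addn1 ltnS -[X in _ <= X]Em; nia.
  by rewrite addnn -[X in X == _]Em.
- move=> [_ m] y /= /orP[/eqP->//|/hasP[z _ /eqP->]].
  rewrite addnn -{1}[z](CodeSeq.decodeK z) -code_cons /hdc CodeSeq.codeK //.
Qed.

(** The same factorisation, now searched for [z]; the exponent is bounded by the code. *)
Lemma computable_tlc n f : computable f -> computable (fun k : ctx n => tlc (f k)).
Proof.
apply: computable1.
apply: (@computable_mu 1 (fun q z => (q.2 == 0) ||
  has (fun y => q.2 == 2 ^ y * (z + z).+1) (iota 0 (q.2 + 1)))) => /=.
- apply: decidable_or; first by apply: decidable_eqn; [computable_var | exact: computable_cst].
  apply: decidable_has.
    by apply: computable_add; [computable_var | exact: computable_cst].
  apply: decidable_eqn; first by computable_var.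
  apply: computable_mul; first by apply: computable_exp2; computable_var.
  by apply/computable_succ/computable_add; computable_var.
- move=> [_ m] /=; rewrite /tlc; case E: (CodeSeq.decode m) (CodeSeq.decodeK m) => [|y s] /=.
    by move=> <-.
  rewrite -/(CodeSeq.code s) => Em; apply/orP; right; apply/hasP; exists y.
    rewrite mem_iota /= add0n addn1 ltnS -[X in _ <= X]Em.
    by have := ltn_expl y (isT : 1 < 2); nia.
  by rewrite addnn -[X in X == _]Em.
- move=> [_ m] z /= /orP[/eqP->//|/hasP[y _ /eqP->]].
  by rewrite addnn -{1}[z](CodeSeq.decodeK z) -code_cons /tlc CodeSeq.codeK /= CodeSeq.decodeK.
Qed.

Definition dropc m i := iter i tlc m.
Definition nthc m i := hdc (dropc m i).

Lemma dropcE m i : dropc m i = CodeSeq.code (drop i (CodeSeq.decode m)).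
Proof.
elim: i => [|i ih]; first by rewrite drop0 CodeSeq.decodeK.
by rewrite /dropc iterS -/(dropc m i) ih /tlc CodeSeq.codeK -drop1 drop_drop add1n.
Qed.

Lemma nthcE m i : nthc m i = nth 0 (CodeSeq.decode m) i.
Proof. by rewrite /nthc dropcE /hdc CodeSeq.codeK -nth0 nth_drop addn0. Qed.

Lemma computable_dropc n f g : computable f -> computable g ->
  computable (fun k : ctx n => dropc (f k) (g k)).
Proof.
move=> hf hg; apply: (@computable_ext _ (fun k => iteri (g k) (fun _ => tlc) (f k))).
  by move=> k; rewrite /dropc; elim: (g k) => //= i ->.
by apply: computable_iteri => //; apply: computable_tlc; computable_var.
Qed.

Lemma computable_nthc n f g : computable f -> computable g ->
  computable (fun k : ctx n => nthc (f k) (g k)).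
Proof. by move=> hf hg; apply/computable_hdc/computable_dropc. Qed.

(** * Graphs generated by words *)

(* The letter pairs (earlier, later) that may be consecutive, and those that are adjacent when
   the two positions are not consecutive ([far]) or are consecutive ([near]); [flip] complements
   both adjacencies. *)
Record system := System {
  follows : seq (nat * nat);
  far : seq (nat * nat);
  near : seq (nat * nat);
  flip : bool }.

Definition ladj (A : system) (next : bool) (a b : nat) : bool :=
  flip A (+) ((a, b) \in if next then near A else far A).

Definition wadj (A : system) (w : nat -> nat) (i j : nat) : bool :=
  if i < j then ladj A (j == i.+1) (w i) (w j)
  else if j < i then ladj A (i == j.+1) (w j) (w i) else false.

(** Words are total functions and [N] is the last position looked at, so prefixes of different
    lengths share one word. *)
Definition walk (A : system) (N : nat) (w : nat -> nat) : bool :=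
  (w 0 == 0) && all (fun i => (w i, w i.+1) \in follows A) (iota 0 N).

Definition occurs (A : system) (w : nat -> nat) (N : nat) (H : sgraph) : bool :=
  [exists f : {ffun H -> 'I_N.+1}, injectiveb f &&
    [forall x, forall y, edge x y == wadj A w (f x) (f y)]].

Definition free_walk A N (L : seq sgraph) w :=
  walk A N w && all (fun H => ~~ occurs A w N H) L.

Lemma walkP A N w : reflect
  (w 0 = 0 /\ forall i, i < N -> (w i, w i.+1) \in follows A) (walk A N w).
Proof.
apply: (iffP andP) => -[h0 h]; split; first exact/eqP.
- by move=> i lt; apply: (allP h); rewrite mem_iota.
- exact/eqP.
- by apply/allP => i; rewrite mem_iota => /h.
Qed.

Lemma occursP A w N (H : sgraph) : reflect
  (exists f : H -> nat, [/\ injective f, forall x, f x <= N &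
     forall x y, edge x y = wadj A w (f x) (f y)]) (occurs A w N H).
Proof.
apply: (iffP existsP) => [[f /andP[/injectiveP fi /forallP fe]]|[f [fi fN fe]]].
  exists (fun x => nat_of_ord (f x)); split=> [x y /val_inj/fi//|x|x y]; first by rewrite -ltnS.
  by have /forallP/(_ y)/eqP := fe x.
exists [ffun x => inord (f x)]; rewrite /=.
have fK x : (inord (f x) : 'I_N.+1) = f x :> nat by rewrite inordK ?ltnS.
apply/andP; split; last first.
  by apply/forallP => x; apply/forallP => y; rewrite !ffunE !fK fe.
by apply/injectiveP => x y; rewrite !ffunE => /(congr1 val); rewrite /= !fK => /fi.
Qed.

Lemma eq_wadj A w w' N i j : (forall k, k <= N -> w k = w' k) -> i <= N -> j <= N ->
  wadj A w i j = wadj A w' i j.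
Proof. by move=> e hi hj; rewrite /wadj !e. Qed.

Lemma eq_occurs A w w' N H : (forall k, k <= N -> w k = w' k) ->
  occurs A w N H = occurs A w' N H.
Proof.
move=> e; apply: eq_existsb => f; congr (_ && _).
apply: eq_forallb => x; apply: eq_forallb => y.
by rewrite (eq_wadj A e) // -ltnS.
Qed.

Lemma eq_free_walk A N L w w' : (forall k, k <= N -> w k = w' k) ->
  free_walk A N L w = free_walk A N L w'.
Proof.
move=> e; congr (_ && _); last by apply: eq_all => H; rewrite (eq_occurs _ _ e).
rewrite /walk e //; congr (_ && _); apply: eq_in_all => i; rewrite mem_iota => lt.
by rewrite !e // ltnW.
Qed.

(** * Exhaustive search through codes of words and occurrences *)

Section Coded.
Variables (A : system).

(** [e] codes the list of images of the vertices. In the code [h] of a graph, entry 0 is the number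
    of vertices and the adjacency matrix follows row by row. *)
Definition occursc s e N h : bool :=
  all (fun a => (nthc e a <= N) &&
    all (fun b => ((a == b) || (nthc e a != nthc e b)) &&
        ((nthc h (a * nthc h 0 + b).+1 == 1) == wadj A (nthc s) (nthc e a) (nthc e b)))
      (iota 0 (nthc h 0)))
    (iota 0 (nthc h 0)).

(** This is [4 * 2 ^ (16 ^ c)], a bound on the number of automaton states times four letters
    ([card_state]). *)
Definition walk_bound c := 2 ^ (2 ^ (c * 4) + 2).
(** Large enough, by [code_lt], for the code of a word of [N + 1] letters below 4 and for that of a
    list of at most [c] positions up to [N], where [N] is [walk_bound c]. *)
Definition code_bound c := 2 ^ ((walk_bound c + 6) * (walk_bound c + c + 1)).

Definition free_walkc c s : bool :=
  walk A (walk_bound c) (nthc s) &&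
  all (fun i => (dropc c i == 0) ||
      all (fun e => ~~ occursc s e (walk_bound c) (nthc c i)) (iota 0 (code_bound c)))
    (iota 0 c).

Definition has_free_walk c : bool := has (free_walkc c) (iota 0 (code_bound c)).

Lemma decidable_wadj n (s f g : ctx n -> nat) :
  computable s -> computable f -> computable g ->
  decidable_in (fun k => wadj A (nthc (s k)) (f k) (g k)).
Proof.
move=> hs hf hg.
have adj (u v : ctx n -> nat) : computable u -> computable v ->
    decidable_in (fun k => ladj A (v k == (u k).+1) (nthc (s k) (u k)) (nthc (s k) (v k))).
  move=> hu hv; pose P k := if v k == (u k).+1
    then (nthc (s k) (u k), nthc (s k) (v k)) \in near A
    else (nthc (s k) (u k), nthc (s k) (v k)) \in far A.
  have hP : decidable_in P.
    apply: decidable_if; [|by apply: decidable_mem2; apply: computable_nthc ..].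
    by apply: decidable_eqn => //; apply: computable_succ.
  have : decidable_in (fun k => flip A (+) P k).
    by case: (flip A); [exact: (decidable_not hP) | exact: hP].
  by apply: computable_ext => k; rewrite /ladj /P; case: ifP.
apply: decidable_if; first by apply: decidable_leq => //; apply: computable_succ.
  exact: adj.
apply: decidable_if; first by apply: decidable_leq => //; apply: computable_succ.
  exact: adj.
exact: computable_cst.
Qed.

Lemma decidable_has_free_walk : decidable_in (fun k : ctx 1 => has_free_walk k.2).
Proof.
have hN n (f : ctx n -> nat) : computable f -> computable (fun k => walk_bound (f k)).
  move=> hf; apply: computable_exp2; apply: computable_add; last exact: computable_cst.
  by apply: computable_exp2; apply: computable_mul => //; apply: computable_cst.
have hB n (f : ctx n -> nat) : computable f -> computable (fun k => code_bound (f k)).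
  move=> hf; apply: computable_exp2; apply: computable_mul.
    by apply: computable_add; [apply: hN | apply: computable_cst].
  apply: computable_add; last exact: computable_cst.
  by apply: computable_add => //; apply: hN.
have hE n (s e N h : ctx n -> nat) : computable s -> computable e -> computable N ->
    computable h -> decidable_in (fun k => occursc (s k) (e k) (N k) (h k)).
  move=> hs he hN' hh.
  have hh0 : computable (fun k => nthc (h k) 0).
    by apply: computable_nthc => //; apply: computable_cst.
  apply: decidable_all => //; apply: decidable_and.
    apply: decidable_leq; last exact: (computable_fst hN').
    by apply: computable_nthc; [exact: (computable_fst he) | computable_var].
  apply: decidable_all; first exact: (computable_fst hh0).
  have hea : computable (fun q : ctx n.+2 => nthc (e q.1.1) q.1.2).
    by apply: computable_nthc; [exact: (computable_fst (computable_fst he)) | computable_var].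
  have heb : computable (fun q : ctx n.+2 => nthc (e q.1.1) q.2).
    by apply: computable_nthc; [exact: (computable_fst (computable_fst he)) | computable_var].
  apply: decidable_and.
    apply: decidable_or; first by apply: decidable_eqn; computable_var.
    by apply: decidable_not; apply: decidable_eqn.
  apply: decidable_eqb; last by apply: decidable_wadj => //;
    exact: (computable_fst (computable_fst hs)).
  apply: decidable_eqn; last exact: computable_cst.
  apply: computable_nthc; first exact: (computable_fst (computable_fst hh)).
  apply/computable_succ/computable_add; last by computable_var.
  by apply: computable_mul; [computable_var | exact: (computable_fst (computable_fst hh0))].
apply: decidable_has; first by apply: hB; computable_var.
apply: decidable_and.
  apply: decidable_and.
    apply: decidable_eqn; last exact: computable_cst.
    by apply: computable_nthc; [computable_var | exact: computable_cst].
  apply: decidable_all; first by apply: hN; computable_var.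
  apply: decidable_mem2; apply: computable_nthc; try computable_var.
  by apply: computable_succ; computable_var.
apply: decidable_all; first by computable_var.
apply: decidable_or.
  apply: decidable_eqn; last exact: computable_cst.
  by apply: computable_dropc; computable_var.
apply: decidable_all; first by apply: hB; computable_var.
apply: decidable_not; apply: hE; try computable_var.
  by apply: hN; computable_var.
by apply: computable_nthc; computable_var.
Qed.

End Coded.

(** Prepending [x] to a list with code [z] gives [2 ^ x * (2 * z + 1)]; the factor [2 ^ (b + 2)]
    absorbs both [2 ^ x] and the rest. *)
Lemma code_lt b s : all (fun x => x < b) s -> CodeSeq.code s < 2 ^ ((b + 2) * size s).
Proof.
elim: s => [|x s ih] /=; first by rewrite muln0.
case/andP=> xb /ih {ih}; rewrite -/(CodeSeq.code s) [(b + 2) * (size s).+1]mulnSr expnD.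
have : 2 ^ x * 4 <= 2 ^ (b + 2).
  by rewrite -[4]/(2 ^ 2) -expnD leq_exp2l // leq_add2r ltnW.
have : 0 < 2 ^ x by rewrite expn_gt0.
set u := 2 ^ x; set t := 2 ^ (b + 2); set v := 2 ^ _; set z := CodeSeq.code s.
rewrite -muln2 => u0 ut zv.
apply: leq_trans (_ : v * (u * 4) <= _); last by rewrite leq_mul2l ut orbT.
by nia.
Qed.

Lemma size_le_code s : size s <= CodeSeq.code s.
Proof.
elim: s => //= x s ih; apply: leq_trans (_ : 1 * (CodeSeq.code s).*2.+1 <= _); first by lia.
by rewrite leq_mul2r expn_gt0 orbT.
Qed.

(** A list is no longer than its code, so the indices below the code cover it; an index past the end
    is recognised by the remaining list having code 0. *)
Lemma all_nthc (P : pred nat) t :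
  all (fun i => (dropc (CodeSeq.code t) i == 0) || P (nthc (CodeSeq.code t) i))
    (iota 0 (CodeSeq.code t)) = all P t.
Proof.
apply/allP/allP => [h x /(nthP 0)[i lt <-]|h i _].
  have := h i; rewrite mem_iota /= add0n (leq_trans lt (size_le_code _)) => /(_ isT).
  rewrite dropcE nthcE CodeSeq.codeK; case E: (drop i t) => //=.
    by move: lt; rewrite ltnNge -subn_eq0 -size_drop E.
  by rewrite muln_eq0 expn_eq0.
rewrite dropcE nthcE CodeSeq.codeK; case: (ltnP i (size t)) => lt.
  by rewrite h ?orbT // mem_nth.
by rewrite drop_oversize.
Qed.

Lemma nth_allpairs (S T R : Type) (x0 : S) (y0 : T) (z0 : R) (f : S -> T -> R) s t a b :
  a < size s -> b < size t ->
  nth z0 [seq f x y | x <- s, y <- t] (a * size t + b) = f (nth x0 s a) (nth y0 t b).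
Proof.
elim: s a => // x s ih [|a] /= ha hb; rewrite nth_cat size_map.
  by rewrite mul0n add0n hb (nth_map y0).
rewrite ltnNge mulSn -addnA leq_addr /= addKn ih //.
Qed.

Lemma nthc_encode_graph0 (G : sgraph) : nthc (encode_graph G) 0 = #|G|.
Proof. by rewrite nthcE CodeSeq.codeK. Qed.

Lemma nthc_encode_graph (G : sgraph) (a b : 'I_#|G|) :
  nthc (encode_graph G) (a * #|G| + b).+1 = edge (enum_val a) (enum_val b).
Proof.
rewrite nthcE CodeSeq.codeK /=.
have := @nth_allpairs _ _ _ (enum_val a) (enum_val b) 0
  (fun x y => nat_of_bool (edge x y)) (enum G) (enum G) a b.
by rewrite -!cardE => -> //; rewrite -!enum_val_nth.
Qed.

Lemma occurscE A N B (H : sgraph) s : 2 ^ ((N + 3) * #|H|) <= B ->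
  all (fun e => ~~ occursc A s e N (encode_graph H)) (iota 0 B) =
  ~~ occurs A (nthc s) N H.
Proof.
move=> hB; rewrite all_predC; congr (~~ _); apply/hasP/occursP.
  move=> [e _ /allP he]; exists (fun x => nthc e (enum_rank x)).
  have hr (x : H) : (enum_rank x : nat) \in iota 0 (nthc (encode_graph H) 0).
    by rewrite mem_iota nthc_encode_graph0 /=.
  have he2 (x y : H) : (x == y) || (nthc e (enum_rank x) != nthc e (enum_rank y)) /\
      edge x y = wadj A (nthc s) (nthc e (enum_rank x)) (nthc e (enum_rank y)).
    have /andP[_ /allP/(_ _ (hr y))] := he _ (hr x).
    rewrite nthc_encode_graph0 nthc_encode_graph !enum_rankK => /andP[h1 /eqP <-].
    split; last by case: (edge x y).
    by rewrite -(inj_eq enum_rank_inj) -(inj_eq val_inj).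
  split=> [x y exy|x|x y]; last by case: (he2 x y).
    by case: (he2 x y); rewrite exy eqxx orbF => /eqP.
  by have /andP[] := he _ (hr x).
move=> [f [fi fN fe]]; pose e := CodeSeq.code [seq f x | x <- enum H].
have eE (a : 'I_#|H|) : nthc e a = f (enum_val a).
  rewrite nthcE CodeSeq.codeK (nth_map (enum_val a)) -?cardE //.
  by rewrite -enum_val_nth.
exists e.
  rewrite mem_iota /= add0n; apply: leq_trans hB.
  have := @code_lt N.+1 [seq f x | x <- enum H].
  rewrite size_map -cardE addSnnS; apply.
  by apply/allP => _ /mapP[x _ ->]; rewrite ltnS.
apply/allP => a; rewrite nthc_encode_graph0 mem_iota /= add0n => ha.
have /= ea := eE (Ordinal ha); rewrite ea fN /=; apply/allP => b; rewrite mem_iota /= add0n => hb.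
have /= eb := eE (Ordinal hb); rewrite eb.
have /= -> := nthc_encode_graph (Ordinal ha) (Ordinal hb); rewrite fe.
apply/andP; split; last by case: (wadj _ _ _ _).
rewrite (inj_eq fi) (inj_eq enum_val_inj) -(inj_eq val_inj) /=.
exact: orbN.
Qed.

(** All families have [r <= 2], so four letters suffice; the automaton uses the alphabet ['I_4]. *)
Definition small_letters A := all (fun p => (p.1 < 4) && (p.2 < 4)) (follows A).

Lemma walk_lt4 A N w i : small_letters A -> walk A N w -> i <= N -> w i < 4.
Proof.
move=> /allP sA /walkP[w0 hw]; case: i => [|i] hi; first by rewrite w0.
by have /andP[] := sA _ (hw i hi).
Qed.

Lemma has_free_walkP A (L : seq sgraph) : small_letters A -> reflect
  (exists w, free_walk A (walk_bound (encode_graphs L)) L w)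
  (has_free_walk A (encode_graphs L)).
Proof.
move=> sA; set c := encode_graphs L; set N := walk_bound c.
have hfree s : free_walkc A c s = free_walk A N L (nthc s).
  rewrite /free_walkc /free_walk; congr (_ && _).
  rewrite (all_nthc (fun h => all (fun e => ~~ occursc A s e (walk_bound c) h)
                                 (iota 0 (code_bound c)))).
  suff hL H : List.In H L -> encode_graph H <= c.
    rewrite all_map; elim: (L) hL => //= H L' ih hL; congr (_ && _); last first.
      by apply: ih => H' hH'; apply: hL; right.
    apply: occurscE; rewrite leq_exp2l //.
    have h1 : #|H| <= encode_graph H.
      have := CodeSeq.ltn_code (CodeSeq.decode (encode_graph H)).
      rewrite CodeSeq.decodeK CodeSeq.codeK => /andP[+ _]; exact: ltnW.
    have h2 := hL H (or_introl erefl); have h3 := leq_trans h1 h2.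
    by apply: leq_mul; rewrite /N; lia.
  move=> hH; have /allP/(_ (encode_graph H)) := CodeSeq.ltn_code (map encode_graph L).
  suff -> : encode_graph H \in map encode_graph L by move/(_ isT)/ltnW.
  elim: (L) hH => //= H' L' ih [->|/ih]; rewrite in_cons ?eqxx // => ->; exact: orbT.
apply: (iffP hasP) => [[s _]|[w hw]]; first by rewrite hfree => hs; exists (nthc s).
(* Only the first [N + 1] letters matter, so the word may be replaced by the code of this prefix. *)
pose s := CodeSeq.code (mkseq w N.+1).
have sE k : k <= N -> w k = nthc s k by move=> hk; rewrite nthcE CodeSeq.codeK nth_mkseq.
exists s; last by rewrite hfree -(eq_free_walk _ _ sE).
rewrite mem_iota /= add0n.
have := @code_lt 4 (mkseq w N.+1); rewrite size_mkseq => h.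
apply: leq_trans (h _) _.
  apply/allP => x /mapP[k]; rewrite mem_iota /= add0n ltnS => hk ->.
  by case/andP: hw => hw _; apply: walk_lt4 hw hk.
by rewrite leq_exp2l // /code_bound -/N; apply: leq_mul; lia.
Qed.

(** * Pumping *)

Lemma wadj_sym A w i j : wadj A w i j = wadj A w j i.
Proof. by rewrite /wadj; case: ltngtP. Qed.

Lemma wadj_lt A w i j : i < j -> wadj A w i j = ladj A (j == i.+1) (w i) (w j).
Proof. by rewrite /wadj => ->. Qed.

Section Profile.
Variable A : system.

(* A state of the automaton recognising the occurrences of [H]: which vertices are already
   placed and on which letters, and which of them, if any, sits at the last position. *)
Definition placement (H : sgraph) : finType :=
  ({ffun H -> option 'I_4} * option H)%type.

Definition places (w : nat -> nat) m (H : sgraph) (q : placement H) (f : H -> nat) : Prop :=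
  [/\ forall x, q.1 x -> f x <= m,
      forall x l, q.1 x = Some l -> w (f x) = l,
      forall x y, q.1 x -> q.1 y -> f x = f y -> x = y,
      forall x y, q.1 x -> q.1 y -> edge x y = wadj A w (f x) (f y) &
      forall x, (q.2 == Some x) = q.1 x && (f x == m)].

(** The state reached by the determinised automaton after reading [w] up to [m]: the set of all
    placements realised there, in boolean form. *)
Definition profile (w : nat -> nat) m (H : sgraph) : {set placement H} :=
  [set q : placement H | [exists f : {ffun H -> 'I_m.+1},
    [&& [forall x, if q.1 x is Some l then w (f x) == l else true],
        [forall x, forall y, q.1 x && q.1 y ==>
          ((f x == f y) ==> (x == y)) && (edge x y == wadj A w (f x) (f y))] &
        [forall x, (q.2 == Some x) == q.1 x && (f x == m :> nat)]]]].

Lemma profileP w m (H : sgraph) (q : placement H) :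
  reflect (exists f, places w m q f) (q \in profile w m H).
Proof.
rewrite inE; apply: (iffP existsP).
  move=> [f /and3P[/forallP h1 /forallP h2 /forallP h3]].
  exists (fun x => nat_of_ord (f x)); split.
  - by move=> x _; rewrite -ltnS.
  - by move=> x l e; have := h1 x; rewrite e => /eqP.
  - move=> x y qx qy /val_inj exy; have /forallP/(_ y) := h2 x.
    by rewrite qx qy exy eqxx => /andP[/eqP].
  - move=> x y qx qy; have /forallP/(_ y) := h2 x.
    by rewrite qx qy => /andP[_ /eqP].
  - by move=> x; rewrite (eqP (h3 x)).
move=> [f [h1 h2 h3 h4 h5]]; exists [ffun x => inord (f x)].
have fK x : q.1 x -> (inord (f x) : 'I_m.+1) = f x :> nat.
  by move/h1; rewrite -ltnS => /inordK.
apply/and3P; split.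
- apply/forallP => x; rewrite ffunE; case E: (q.1 x) => [l|//].
  by rewrite fK ?E //; apply/eqP/h2.
- apply/forallP => x; apply/forallP => y; rewrite !ffunE.
  apply/implyP => /andP[qx qy]; rewrite !fK // h4 // eqxx andbT.
  by apply/implyP => /eqP/(congr1 val); rewrite /= !fK // => /(h3 _ _ qx qy)/eqP.
- apply/forallP => x; rewrite ffunE h5; case E: (q.1 x : bool) => //=.
  by rewrite fK.
Qed.

Lemma eq_profile w w' m H : (forall k, k <= m -> w k = w' k) ->
  profile w m H = profile w' m H.
Proof.
suff sub u v : (forall k, k <= m -> u k = v k) -> {subset profile u m H <= profile v m H}.
  by move=> e; apply/setP => q; apply/idP/idP; apply: sub => // k hk; rewrite e.
move=> e q /profileP[f [h1 h2 h3 h4 h5]]; apply/profileP; exists f; split=> //.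
- by move=> x l qx; rewrite -e ?h1 ?qx //; apply: h2.
- by move=> x y qx qy; rewrite h4 //; apply: (eq_wadj A e); apply: h1.
Qed.

(** The adjacency of a vertex at [m.+1] to an earlier one depends on their letters and on whether
    the earlier one sits at [m]. A placement records all of this, so an occurrence can be rebuilt in
    the other word. *)
Lemma profile_step w m w' m' H :
  profile w m H = profile w' m' H -> w m.+1 = w' m'.+1 ->
  profile w m.+1 H \subset profile w' m'.+1 H.
Proof.
move=> eP ew; apply/subsetP => q /profileP[f [h1 h2 h3 h4 h5]].
(* Remove the vertex placed at [m.+1], if there is one; what remains is a placement up to [m]. *)
pose lab : {ffun H -> option 'I_4} := [ffun x => if q.2 == Some x then None else q.1 x].
have labE x : lab x = q.1 x && (q.2 != Some x) :> bool.
  by rewrite ffunE; case: ifP; rewrite ?andbF ?andbT.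
have flab x : lab x -> f x <= m.
  rewrite labE h5 => /andP[qx]; rewrite qx /= => ne.
  by have := h1 x qx; rewrite leq_eqVlt (negPf ne).
pose lst := [pick x | lab x && (f x == m)].
have lstE x : (lst == Some x) = lab x && (f x == m).
  rewrite /lst; case: pickP => [z /andP[lz /eqP fz]|/(_ x) -> //].
  apply/eqP/andP => [[<-]|[lx /eqP fx]]; first by rewrite fz.
  congr Some; move: lz lx; rewrite !labE => /andP[qz _] /andP[qx _].
  by apply: h3; rewrite ?fz ?fx.
have : (lab, lst) \in profile w m H.
  apply/profileP; exists f; split=> //=.
  - by move=> x l; rewrite ffunE; case: ifP => // _; apply: h2.
  - by move=> x y; rewrite !labE => /andP[qx _] /andP[qy _]; apply: h3.
  - by move=> x y; rewrite !labE => /andP[qx _] /andP[qy _]; apply: h4.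
rewrite eP => /profileP[g [/= g1 g2 g3 g4 g5]].
(* The remaining vertices go where the other word realises them, and the removed one to its new last
   position. *)
pose f' x := if q.2 == Some x then m'.+1 else g x.
have new x : q.2 == Some x -> q.1 x /\ f x = m.+1.
  by rewrite h5 => /andP[? /eqP].
have link x y : q.1 x -> q.2 != Some x -> q.2 == Some y ->
    wadj A w (f x) (f y) = wadj A w' (g x) m'.+1.
  move=> qx nx hy; have [qy ->] := new y hy.
  have lx : lab x by rewrite labE qx.
  rewrite !wadj_lt ?ltnS ?flab ?g1 // !eqSS ![m == _]eq_sym ![m' == _]eq_sym.
  move: (lstE x) (g5 x); rewrite lx /= => -> <-; rewrite ew.
  case E: (lab x) lx => [l|//] _; rewrite (g2 _ _ E); congr (ladj _ _ _ _).
  by move: E; rewrite ffunE; case: ifP => // _ /h2.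
apply/profileP; exists f'; split.
- move=> x qx; rewrite /f'; case: ifP => // ne.
  by apply: leqW; apply: g1; rewrite labE qx ne.
- move=> x l qx; rewrite /f'; case: ifP => [hx|ne].
    by rewrite -ew -(h2 x l qx) (proj2 (new x hx)).
  by apply: g2; rewrite ffunE ne.
- move=> x y qx qy; rewrite /f'; case: ifP => [hx|nx]; case: ifP => [hy|ny].
  + by move: hx hy => /eqP-> /eqP[].
  + by move=> e; have := g1 y; rewrite labE qy ny -e ltnn => /(_ isT).
  + by move=> e; have := g1 x; rewrite labE qx nx e ltnn => /(_ isT).
  + by apply: g3; rewrite labE ?qx ?qy ?nx ?ny.
- move=> x y qx qy; rewrite /f' h4 //; case: ifP => [hx|nx]; case: ifP => [hy|ny].
  + by rewrite (proj2 (new x hx)) (proj2 (new y hy)) /wadj !ltnn.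
  + by rewrite wadj_sym [RHS]wadj_sym; apply: link; rewrite ?ny.
  + by apply: link; rewrite ?nx.
  + by rewrite -h4 // g4 // labE ?qx ?qy ?nx ?ny.
- move=> x; rewrite /f'; case: ifP => [/new[-> _]|nx]; first by rewrite eqxx.
  case qx: (q.1 x : bool) => //=; apply/esym/negbTE; rewrite neq_ltn ltnS g1 //.
  by rewrite labE qx nx.
Qed.

Lemma profile_occurs w m H : (forall k, k <= m -> w k < 4) ->
  occurs A w m H = [exists q in profile w m H, [forall x, q.1 x : bool]].
Proof.
move=> w4; apply/occursP/existsP.
  move=> [f [fi fm fe]].
  pose lst := [pick x | f x == m].
  exists ([ffun x => Some (inord (w (f x)))], lst); apply/andP; split; last first.
    by apply/forallP => x; rewrite ffunE.
  apply/profileP; exists f; split=> //=.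
  - by move=> x l; rewrite ffunE => -[<-]; rewrite inordK // w4.
  - by move=> x y _ _; apply: fi.
  - move=> x; rewrite ffunE /= /lst; case: pickP => [z /eqP fz|/(_ x) -> //].
    apply/eqP/eqP => [[<-//]|fx]; congr Some; apply: fi; congruence.
move=> [q /andP[/profileP[f [h1 _ h3 h4 _]] /forallP tot]].
by exists f; split=> [x y|x|x y]; [apply: h3 | apply: h1 | apply: h4].
Qed.

Fixpoint state (L : seq sgraph) : finType :=
  if L is H :: L' then ({set placement H} * state L')%type else unit.

Fixpoint state_of w m (L : seq sgraph) : state L :=
  if L is H :: L' return state L then (profile w m H, state_of w m L') else tt.

Lemma eq_state_of w w' m L : (forall k, k <= m -> w k = w' k) ->
  state_of w m L = state_of w' m L.
Proof. by move=> e; elim: L => //= H L ->; rewrite (eq_profile _ e). Qed.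

Lemma state_step w m w' m' L : state_of w m L = state_of w' m' L ->
  w m.+1 = w' m'.+1 -> state_of w m.+1 L = state_of w' m'.+1 L.
Proof.
move=> + ew; elim: L => //= H L ih [eP eS]; congr (_, _); last exact: ih.
by apply/eqP; rewrite eqEsubset !profile_step.
Qed.

Lemma state_free w m w' m' L :
  (forall k, k <= m -> w k < 4) -> (forall k, k <= m' -> w' k < 4) ->
  state_of w m L = state_of w' m' L ->
  all (fun H => ~~ occurs A w m H) L = all (fun H => ~~ occurs A w' m' H) L.
Proof.
move=> w4 w'4; elim: L => //= H L ih [eP /ih ->].
by rewrite !profile_occurs ?eP.
Qed.

Lemma occurs_leq w m n H : m <= n -> occurs A w m H -> occurs A w n H.
Proof.
move=> mn /occursP[f [fi fm fe]]; apply/occursP; exists f; split=> // x.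
exact: leq_trans (fm x) mn.
Qed.

(* Once two positions of a free walk carry the same state and letter, the segment between
   them can be repeated forever. *)
Lemma pumping N L w : small_letters A -> #|state L| * 4 <= N -> free_walk A N L w ->
  exists w', forall n, free_walk A n L w'.
Proof.
move=> sA hN /andP[ww free]; have w4 i : i <= N -> w i < 4 by apply: walk_lt4 ww.
pose cfg (i : 'I_N.+1) := (state_of w i L, inord (w i) : 'I_4).
have [i [j [ltij [est ew]]]] : exists i j : 'I_N.+1,
    i < j /\ state_of w i L = state_of w j L /\ w i = w j.
  have : ~~ injectiveb cfg.
    by apply/negP => /injectiveP/leq_card; rewrite card_prod !card_ord leqNgt ltnS hN.
  case/injectivePn => i [j ne [est ew]].
  have {}ew : w i = w j.
    by move/(congr1 val): ew; rewrite /= !inordK // w4 // -ltnS.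
  case: (ltngtP i j) => [lt|lt|/val_inj/eqP]; last by rewrite (negPf ne).
    by exists i, j.
  by exists j, i.
(* [rho] counts upwards but returns to [i] instead of reaching [j], so [w \o rho] repeats the
   segment from [i] to [j - 1] forever. *)
pose rho k := iter k (fun p => if p.+1 == j then i : nat else p.+1) 0.
have rhoS k : rho k.+1 = if (rho k).+1 == j then i : nat else (rho k).+1 by [].
have rho_lt k : rho k < j.
  elim: k => [|k ih]; first exact: leq_ltn_trans ltij.
  by rewrite rhoS; case: ifP => // ne; rewrite ltn_neqAle ne.
have jN : j <= N by rewrite -ltnS.
pose w' := w \o rho.
have hw k : w (rho k.+1) = w (rho k).+1.
  by rewrite rhoS; case: ifP => // /eqP ->.
(* The positions [i] and [j] carry the same state, so the automaton does not notice the jump. *)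
have hst k : state_of w' k L = state_of w (rho k) L.
  elim: k => [|k ih]; first by apply: eq_state_of => k; rewrite leqn0 => /eqP->.
  rewrite (state_step (w' := w) (m' := rho k) ih) //; last exact: hw.
  by rewrite rhoS; case: ifP => // /eqP ->.
have rN k : rho k <= N by apply: leq_trans jN; apply: ltnW.
exists w' => n; apply/andP; split.
  case/walkP: ww => w0 hww; apply/walkP; split=> // k _; rewrite /w' /= hw.
  by apply: hww; apply: leq_trans jN.
rewrite (state_free _ _ (hst n)); last 2 first.
- by move=> k _; apply: w4.
- by move=> k hk; apply: w4; apply: leq_trans hk (rN n).
by apply: sub_all free => H; apply: contra; apply: occurs_leq.
Qed.

(** A graph with [n] vertices has [5 ^ n * n.+1] placements, and a profile is a set of placements.
    Hence the number of states is 2 to the sum of these numbers, and the sum stays below [16 ^ c]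
    for the code [c] of the list. *)
Lemma card_state L : #|state L| * 4 <= walk_bound (encode_graphs L).
Proof.
have [b [-> hb]] : exists b, #|state L| = 2 ^ b /\ b.+1 <= 16 ^ encode_graphs L.
  elim: L => [|H L [b [e hb]]]; first by exists 0; rewrite card_unit.
  exists (5 ^ #|H| * #|H|.+1 + b).
  rewrite /= card_prod e -cardsT -powersetT card_powerset cardsT.
  rewrite card_prod card_ffun !card_option card_ord -expnD; split=> //.
  rewrite /encode_graphs /= -/(encode_graphs L) -/(CodeSeq.code _).
  set n := #|H|; set h := encode_graph H; set c := encode_graphs L in hb *.
  have nh : n < 2 ^ h.
    apply: leq_trans (ltn_expl _ (isT : 1 < 2)); rewrite ltnS.
    have := CodeSeq.ltn_code (CodeSeq.decode h).
    by rewrite CodeSeq.decodeK CodeSeq.codeK => /andP[/ltnW].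
  have h1 : 5 ^ n * n.+1 <= 16 ^ n.
    apply: leq_trans (_ : 8 ^ n * 2 ^ n <= _); last by rewrite -expnMn.
    by apply: leq_mul; [case: (n) => // k; rewrite leq_exp2r | apply: ltn_expl].
  have : 16 ^ (maxn n c).+1 <= 16 ^ (2 ^ h * c.*2.+1).
    rewrite leq_exp2l //; have : 0 < 2 ^ h by rewrite expn_gt0.
    by case: leqP; nia.
  apply: leq_trans; rewrite expnS.
  have := leq_pexp2l (isT : 0 < 16) (leq_maxl n c).
  have := leq_pexp2l (isT : 0 < 16) (leq_maxr n c).
  lia.
by rewrite /walk_bound expnD leq_mul2r leq_exp2l // mulnC expnM orbC ltnW.
Qed.

End Profile.

(** * Prime word graphs *)

(* [(r, D, s)] generates the words 0 ... (r-1) r (r+1) r (r+1) ...: the first [r] letters are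
   single vertices and the other vertices come in blocks of two. [D] lists the adjacent letter
   pairs (earlier, later), except that two vertices of the same block are adjacent iff [s]. *)
Definition pattern_family := (nat * seq (nat * nat) * bool)%type.

(** Each letter has a single successor, so the word is forced. Consecutive letters [r], [r.+1] are
    the two vertices of a block, the only pair on which [near] may differ from [far]. *)
Definition fam_system (F : pattern_family) (b : bool) : system :=
  let: (r, D, s) := F in
  System ((r.+1, r) :: [seq (i, i.+1) | i <- iota 0 r.+1]) D
    [seq p <- (r, r.+1) :: D | (p != (r, r.+1)) || s] b.

Definition fam_word (r p : nat) : nat := if p < r then p else r + odd (p - r).

(* In this order: subdivided star, thin spider, thick spider, complement of the line graph of
   K_(2,n), half-graph, and a threshold graph extended in three ways by one or two vertices. *)
Definition families : seq pattern_family :=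
  [:: (1, [:: (0, 1)], true);
      (0, [:: (1, 1)], true);
      (0, [:: (1, 1); (0, 1); (1, 0)], false);
      (0, [:: (0, 1); (1, 0)], false);
      (0, [:: (0, 1)], true);
      (1, [:: (0, 2); (1, 1); (1, 2)], true);
      (2, [:: (0, 1); (1, 2); (2, 2); (2, 3)], true);
      (2, [:: (0, 2); (0, 3); (1, 3); (3, 3); (3, 2)], false)].

(** The letter of the later vertex decides: with 0 it sees only its predecessor among the earlier
    vertices, with 1 all of them but its predecessor. *)
Definition chain_system : system :=
  System [:: (0, 0); (0, 1); (1, 0); (1, 1)] [:: (0, 1); (1, 1)] [:: (0, 0); (1, 0)] false.

Definition systems : seq system :=
  chain_system :: [seq fam_system F b | F <- families, b <- [:: false; true]].

Definition module_closed A w len (X : nat -> bool) := forall v a b,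
  v < len -> a < len -> b < len -> ~~ X v -> X a -> X b -> wadj A w v a = wadj A w v b.

Definition prime_word A w len := forall X, module_closed A w len X ->
  forall p q, p < len -> q < len -> p != q -> X p -> X q -> forall v, v < len -> X v.

Fixpoint bitseqs n : seq bitseq :=
  if n is m.+1 then [seq b :: s | b <- [:: false; true], s <- bitseqs m] else [:: [::]].

Definition prime_test A w len :=
  all (fun s => let X := nth false s in
    (count id s <= 1) || (all id s) ||
    has (fun v => has (fun a => has (fun b =>
      [&& ~~ X v, X a, X b & wadj A w v a != wadj A w v b])
      (iota 0 len)) (iota 0 len)) (iota 0 len)) (bitseqs len).

Lemma mem_bitseqs (s : bitseq) : s \in bitseqs (size s).
Proof.
elim: s => // b s ih; rewrite [bitseqs _]/= cats0 mem_cat.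
by case: b; rewrite ?map_f ?orbT.
Qed.

Lemma prime_testP A w len : prime_test A w len -> prime_word A w len.
Proof.
move=> /allP test X cX p q hp hq ne Xp Xq v hv.
pose s := mkseq X len; have ss : size s = len by rewrite size_mkseq.
have sE i : i < len -> nth false s i = X i by move=> h; rewrite nth_mkseq.
have := test s; rewrite -{1}ss mem_bitseqs => /(_ isT) /orP[/orP[|]|].
- suff : 1 < count id s by case: leqP.
  rewrite count_map -size_filter; set t := filter _ _.
  have : {subset [:: p; q] <= t}.
    move=> x; rewrite !inE mem_filter mem_iota /= => /orP[]/eqP->.
      by rewrite Xp hp.
    by rewrite Xq hq.
  by move/uniq_leq_size => /=; rewrite inE ne; apply.
- by move/allP/(_ (X v)); apply; apply: map_f; rewrite mem_iota.
case/hasP=> u; rewrite mem_iota /= add0n => hu /hasP[a].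
rewrite mem_iota /= add0n => ha /hasP[b]; rewrite mem_iota /= add0n => hb.
by rewrite !sE // => /and4P[nu xa xb]; rewrite (cX u a b) ?eqxx.
Qed.

Lemma ladj_fam F b next x y : (x, y) != (F.1.1, F.1.1.+1) ->
  ladj (fam_system F b) next x y = b (+) ((x, y) \in F.1.2).
Proof.
case: F => [[r D] s] /= ne; case: next => //.
change (b (+) ((x, y) \in [seq p <- (r, r.+1) :: D | (p != (r, r.+1)) || s]) =
        b (+) ((x, y) \in D)).
by rewrite mem_filter ne in_cons (negPf ne).
Qed.

Lemma fam_word_skip r j p : fam_word r (if p < r + j.*2 then p else p.+2) = fam_word r p.
Proof.
rewrite /fam_word; case: (ltnP p (r + j.*2)) => // hp.
have hr : r <= p by lia.
rewrite !ltnNge hr (leq_trans hr) ?leqW //=.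
have -> : p.+2 - r = (p - r).+2 by lia.
by rewrite /= negbK.
Qed.

(* Whether a vertex belongs to the module generated by two others involves at most three blocks,
   so it is decided inside the smaller graph obtained by deleting any other block. *)
Lemma prime_fam_word F b n : 3 <= n ->
  prime_word (fam_system F b) (fam_word F.1.1) (F.1.1 + 6) ->
  prime_word (fam_system F b) (fam_word F.1.1) (F.1.1 + n.*2).
Proof.
set A := fam_system F b; set r := F.1.1; set w := fam_word r.
move=> n3 base; elim: n n3 => // n ih; rewrite leq_eqVlt => /orP[/eqP <- //|n3].
have {}ih := ih n3; move=> X cX p q hp hq ne Xp Xq v hv.
(* Three positions cannot meet all of the first four blocks; a block [j] avoiding them is skipped by
   [h]. *)
have [j j4 hj] : exists2 j, j < 4 & j \notin [:: (p - r)./2; (q - r)./2; (v - r)./2].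
  have /allPn[j] : ~~ all (mem [:: (p - r)./2; (q - r)./2; (v - r)./2]) (iota 0 4).
    by apply/negP => /allP/(uniq_leq_size (iota_uniq 0 4)).
  by rewrite mem_iota => j4 hj; exists j.
pose h i := if i < r + j.*2 then i else i.+2.
have hn i : i < r + n.*2 -> h i < r + n.+1.*2 by rewrite /h; case: ifP; lia.
have onto i : i < r + n.+1.*2 -> (i - r)./2 != j -> exists2 i', i' < r + n.*2 & h i' = i.
  move=> hi nj; case: (ltnP i (r + j.*2)) => lt; first by exists i; rewrite /h ?lt //; lia.
  exists (i - 2); first by lia.
  by rewrite /h; case: ifP; lia.
have hw a c : wadj A w (h a) (h c) = wadj A w a c.
  wlog lt : a c / a < c.
    move=> sym; case: (ltngtP a c) => [/sym//|/sym e|->]; last by rewrite /wadj !ltnn.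
    by rewrite wadj_sym e wadj_sym.
  have lth : h a < h c by rewrite /h; do 2 case: ifP; lia.
  rewrite !wadj_lt // /w !fam_word_skip.
  (* Skipping block [j] affects consecutiveness only at [c = r + j.*2]. The letter there is [r],
     while [near] and [far] differ only if the later letter is [r.+1]. *)
  case: (boolP ((h c == (h a).+1) == (c == a.+1))) => [/eqP -> //|ne'].
  have ec : c = r + j.*2.
    by move: ne' lt; rewrite /h; do 2 case: ifP; move=> ? ?; rewrite ?eqSS ?eqxx //;
      case: eqP; case: eqP => //; lia.
  have wc : fam_word r c = r by rewrite /fam_word ec ltnNge leq_addr addKn odd_double addn0.
  by rewrite !ladj_fam // -/r wc xpair_eqE (ltn_eqF (ltnSn r)) andbF.
have cX' : module_closed A w (r + n.*2) (X \o h).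
  move=> u a c hu ha hc nu Xa Xc.
  by rewrite -(hw u a) -(hw u c); apply: cX => //; apply: hn.
move: hj; rewrite !inE !negb_or => /and3P[].
rewrite ![j == _]eq_sym => /(onto _ hp)[p' hp' ep] /(onto _ hq)[q' hq' eq] /(onto _ hv)[v' hv' ev].
rewrite -ev; apply: (ih (X \o h) cX' p' q') => //=; rewrite ?ep ?eq //.
by apply: contraNneq ne => e; rewrite -ep -eq e.
Qed.

(** The base case of three blocks, for every family and its complement, by enumeration of all vertex
    subsets. *)
Lemma families_test : all (fun F => all (fun b =>
  prime_test (fam_system F b) (fam_word F.1.1) (F.1.1 + 6)) [:: false; true]) families.
Proof. by vm_compute. Qed.

Lemma families_prime F b n : F \in families -> 3 <= n ->
  prime_word (fam_system F b) (fam_word F.1.1) (F.1.1 + n.*2).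
Proof.
move=> /(allP families_test) /allP h n3; apply: prime_fam_word n3 _.
by apply/prime_testP/h; case: b; rewrite !inE.
Qed.

Lemma ladj_chain next a b : a < 2 -> b < 2 -> ladj chain_system next a b = next (+) (b == 1).
Proof. by case: next; case: a => [|[|//]] _; case: b => [|[|//]]. Qed.

(* Non-trivial modules of a chain only occur when the inner letters are all equal, and never
   when all letters are equal: in that case the chain is a path or the complement of one. *)
Lemma chain_module w n X : 5 < n -> (forall i, w i < 2) ->
  module_closed chain_system w n.+1 X ->
  forall p q v, p <= n -> q <= n -> v <= n -> p != q -> X p -> X q -> ~~ X v ->
  (forall i j, 2 < i -> i.+1 < n -> 2 < j -> j.+1 < n -> w i = w j) /\
  (exists i j, [/\ 0 < i <= n, 0 < j <= n & w i != w j]).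
Proof.
move=> n5 w2 cX p q v.
wlog ltpq : p q / p < q.
  move=> sym hp hq hv ne Xp Xq; case: (ltngtP p q) (ne) => // lt _; first exact: (sym p q).
  by apply: (sym q p) => //; rewrite eq_sym.
move=> _ hq hv _ Xp Xq Xv.
pose e i := w i == 1.
have ee i j : e i = e j -> w i = w j.
  by rewrite /e; case: (w i) (w2 i) => [|[|//]]; case: (w j) (w2 j) => [|[|//]].
have C i j : i < j -> wadj chain_system w i j = (j == i.+1) (+) e j.
  by move=> lt; rewrite wadj_lt // ladj_chain.
have {}cX c x y : c <= n -> x <= n -> y <= n -> ~~ X c -> X x -> X y ->
    wadj chain_system w c x = wadj chain_system w c y by move=> *; apply: cX.
(* [a] and [b] are the two smallest elements of the module. *)
have [a Xa amin] := ex_minnP (ex_intro X p Xp).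
have exb : exists b, (a < b) && X b.
  by exists q; rewrite Xq andbT (leq_ltn_trans (amin p Xp)).
have [b /andP[ab Xb] bmin] := ex_minnP exb.
have bq : b <= q by apply: bmin; rewrite Xq (leq_ltn_trans (amin p Xp)).
have bn : b <= n := leq_trans bq hq.
have low c : c < b -> c != a -> ~~ X c.
  move=> cb ca; apply/negP => Xc; have := amin c Xc; rewrite leq_eqVlt eq_sym (negPf ca) /=.
  by move=> ac; have := bmin c; rewrite ac Xc => /(_ isT); rewrite leqNgt cb.
(* A non-member [c.+1] after [b] would distinguish its predecessor [c] from [a]. *)
have up c : b <= c -> c <= n -> X c.
  elim: c => [|c ih]; first by rewrite leqn0 => /eqP <-.
  rewrite leq_eqVlt => /orP[/eqP<- //|bc] cn; apply/negPn/negP => nX.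
  have := cX c.+1 c a cn (ltnW cn) _ nX (ih bc (ltnW cn)) Xa.
  rewrite !(wadj_sym _ _ c.+1) !C //; last by lia.
  have -> : (c.+1 == a.+1) = false by lia.
  by rewrite eqxx => /(_ ltac:(lia)); case: (e _).
have R c j : c < a \/ a < c < b -> b <= j <= n -> c.+1 < j -> e j = wadj chain_system w c b.
  move=> hc /andP[bj jn] cj.
  rewrite (cX c b j) //; [rewrite C; lia |lia|by apply: low; lia|by apply: up; lia].
have Ra c j : c < a \/ a < c < b -> b <= j <= n -> c.+1 < j -> e j = wadj chain_system w c a.
  move=> hc hj cj; rewrite (R c) //; apply: cX => //; try lia.
  by apply: low; lia.
(* If [b < n], the letters after [b] (after [a] if [b = a.+1]) are opposite to the letter there. A
   non-member at least two places before it would contradict this, so it is one of the first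
   positions. If [b = n], comparing [a.-1] and [a - 2] shows [a < 2], and the letters from [a.+2] on
   are equal up to [n - 2]. *)
case: (ltngtP b n) bn => // bn _.
  case: (ltngtP a.+1 b) ab => // ab _.
    have h j : b < j <= n -> e j = ~~ e b.
      move=> hj; rewrite (R b.-1 j); [|lia..].
      by rewrite C; [have -> : (b == b.-1.+1) = true by lia | lia].
    case: (ltnP b 3) => b3.
      split=> [i j *|]; first by apply: ee; rewrite (h i) ?(h j) //; lia.
      exists b, b.+1; split; try lia; apply/eqP => E; have := h b.+1.
      by rewrite /e -E => /(_ ltac:(lia)); case: (_ == _).
    pose c := (a == 0) : nat.
    have hc : c != a by rewrite /c; case: (a).
    have c1 : c <= 1 by rewrite /c; case: (_ == _).
    have := R c b.+1; rewrite h; last by lia.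
    rewrite C; last by lia.
    have -> : (b == c.+1) = false by lia.
    by move=> /(_ ltac:(lia) ltac:(lia) ltac:(lia)); case: (e b).
  have a0 : 0 < a.
    rewrite lt0n; apply: contraNneq Xv => a0; case: (posnP v) => [->|v0]; first by rewrite -a0.
    by apply: up; lia.
  have h j : a < j <= n -> e j = ~~ e a.
    move=> hj; rewrite (Ra a.-1 j); [|lia..].
    by rewrite C; [rewrite prednK // eqxx | lia].
  case: (ltnP a 2) => a1.
    split=> [i j *|]; first by apply: ee; rewrite (h i) ?(h j) //; lia.
    exists 1, 2; split; try lia; apply/eqP => E; have := h 2.
    by have a1' : a = 1; [lia | rewrite a1' /e -E => /(_ ltac:(lia)); case: (_ == _)].
  have := Ra (a - 2) a.+1; rewrite h; last by lia.
  rewrite C; last by lia.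
  have -> : (a == (a - 2).+1) = false by lia.
  by move=> /(_ ltac:(lia) ltac:(lia) ltac:(lia)); case: (e a).
subst b.
have Xlow c : c < n -> c != a -> ~~ X c by apply: low.
have D c : c < n -> c != a -> wadj chain_system w c a = (n == c.+1) (+) e n.
  move=> cn ca; rewrite -C //; apply: cX => //; [lia | lia | exact: Xlow].
case: (ltnP a 2) => a2; last first.
  have := D (a - 2); rewrite C; last by lia.
  have := D a.-1; rewrite C; last by lia.
  have -> : (a == a.-1.+1) by lia.
  have -> : (n == a.-1.+1) = false by lia.
  have -> : (a == (a - 2).+1) = false by lia.
  have -> : (n == (a - 2).+1) = false by lia.
  move=> /(_ ltac:(lia) ltac:(lia)) h1 /(_ ltac:(lia) ltac:(lia)) h2.
  by move: h1 h2; case: (e a); case: (e n).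
have h c : a.+1 < c < n -> e c = (n == c.+1) (+) e n.
  move=> hc; rewrite -D; [|lia..].
  by rewrite wadj_sym C; [have -> : (c == a.+1) = false by lia | lia].
split=> [i j *|].
  by apply: ee; rewrite (h i) ?(h j); [congr (_ (+) _)|..]; lia.
exists n.-1, n; split; try lia; apply/eqP => E; have := h n.-1.
rewrite /e E prednK ?eqxx; last by lia.
by move=> /(_ ltac:(lia)); case: (_ == 1).
Qed.

(** By [chain_module] the whole chain is prime unless the letters at 3 to [n - 2] agree. In that
    case the window from 2 to [n - 2] has equal letters after its first vertex, which excludes
    modules as well. *)
Lemma chain_prime_window w n : 9 < n -> (forall i, w i < 2) -> exists k len,
  [/\ n <= len + 3, k + len <= n.+1 & prime_word chain_system (fun i => w (k + i)) len].
Proof.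
move=> n9 w2.
case: (boolP (all (fun i => w i == w 3) (iota 3 (n - 4)))) => [/allP cst|ncst].
  exists 2, (n - 4).+1; split; try lia; move=> X cX p q hp hq ne Xp Xq v hv.
  apply/negPn/negP => Xv.
  have [|_ [i [j [hi hj /eqP[]]]]] :=
    @chain_module (fun i => w (2 + i)) (n - 4) X ltac:(lia) _ cX p q v hp hq hv ne Xp Xq Xv.
    by move=> i; apply: w2.
  by rewrite (eqP (cst (2 + i) _)) ?(eqP (cst (2 + j) _)) // mem_iota; lia.
exists 0, n.+1; split; try lia; move=> X cX p q hp hq ne Xp Xq v hv.
apply/negPn/negP => Xv; case/negP: ncst; apply/allP => i; rewrite mem_iota => hi.
have [h _] := @chain_module w n X ltac:(lia) w2 cX p q v hp hq hv ne Xp Xq Xv.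
by apply/eqP/h; lia.
Qed.

(** * From prime words to infinitely many prime graphs *)

Lemma wadj_irr A w : irreflexive (wadj A w).
Proof. by move=> i; rewrite /wadj ltnn. Qed.

Lemma wadj_shift A w k i j : wadj A (fun i => w (k + i)) i j = wadj A w (k + i) (k + j).
Proof. by rewrite /wadj !ltn_add2l -!addnS !eqn_add2l. Qed.

Section WordGraph.
Variables (A : system) (w : nat -> nat) (len : nat).

Definition word_edge : rel 'I_len := fun i j => wadj A w i j.

Lemma word_edge_sym : symmetric word_edge.
Proof. by move=> i j; apply: wadj_sym. Qed.

Lemma word_edge_irrefl : irreflexive word_edge.
Proof. by move=> i; apply: wadj_irr. Qed.

Definition word_graph := SGraph word_edge_sym word_edge_irrefl.

Lemma card_word_graph : #|word_graph| = len.
Proof. exact: card_ord. Qed.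

Lemma prime_word_graph : prime_word A w len -> prime_graph word_graph.
Proof.
move=> pw [X [/andP[/card_gt1P[x [y [Xx Xy ne]]] lt] hX]].
pose Y i := [exists x in X, (x : nat) == i].
have YE (i : 'I_len) : Y i = (i \in X).
  apply/existsP/idP => [[z /andP[zX /eqP/val_inj <-//]]|iX].
  by exists i; rewrite iX eqxx.
have cY : module_closed A w len Y.
  move=> v a b hv ha hb; rewrite (YE (Ordinal hv)) (YE (Ordinal ha)) (YE (Ordinal hb)).
  move=> vX aX bX; case: (hX _ vX) => h.
    by rewrite (h _ aX : is_true (wadj A w v a)) (h _ bX : is_true (wadj A w v b)).
  by rewrite (negbTE (h _ aX : ~~ wadj A w v a)) (negbTE (h _ bX : ~~ wadj A w v b)).
have full : X = [set: 'I_len].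
  apply/setP => v; rewrite inE -YE; apply: (pw _ cY x y) => //; by rewrite YE.
by move: lt; rewrite full cardsT ltnn.
Qed.
End WordGraph.

Lemma induced_subgraphP (H G : sgraph) : induced_subgraph H G <->
  exists f : H -> G, injective f /\ forall x y, edge (f x) (f y) = edge x y.
Proof.
split=> [[S [f [g fK gK] fe]]|[f [fi fe]]].
  by exists (fun x => val (f x)); split=> [x y /val_inj/(can_inj fK)|x y] //; apply: fe.
have imf x : f x \in [set f y | y in H] by apply: imset_f.
exists [set f y | y in H].
pose g x : restr [set f y | y in H] := exist _ (f x) (imf x).
have gi : injective g by move=> x y /(congr1 val) /fi.
exists g; last by move=> x y; rewrite -fe.
apply: (inj_card_bij gi); rewrite /restr /= card_sig.
by rewrite -(card_imset _ fi); apply: subset_leq_card; apply/subsetP => y; rewrite inE.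
Qed.

Lemma free_word_graph A N L w k len : free_walk A N L w -> k + len <= N ->
  Free (fun H => List.In H L) (word_graph A (fun i => w (k + i)) len).
Proof.
move=> /andP[_ free] le H hH /induced_subgraphP[f [fi fe]].
suff : occurs A w N H.
  elim: L free hH => //= H' L ih /andP[nH' free] [<-|/ih]; last exact.
  by rewrite (negPf nH').
apply/occursP; exists (fun x => k + f x); split=> [x y /addnI/val_inj/fi//|x|x y].
  by apply: leq_trans le; rewrite leq_add2l ltnW.
by rewrite -wadj_shift -fe.
Qed.

(** Choosing each graph with more vertices than the one before makes the orders strictly increasing,
    hence the graphs pairwise non-isomorphic. *)
Lemma infinitely_manyP (C : sgraph -> Prop) :
  (forall n, exists G, C G /\ n <= #|G|) -> infinitely_many_up_to_iso C.
Proof.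
move=> /functional_choice[g hg].
pose h k := iter k (fun m => #|g m|.+1) 0.
have hS k : #|g (h k)| < h k.+1 by [].
have incr i j : i < j -> #|g (h i)| < #|g (h j)|.
  elim: j => // j ih; rewrite ltnS leq_eqVlt => /orP[/eqP ->|/ih lt].
    exact: leq_trans (hS j) (proj2 (hg _)).
  exact: leq_trans lt (ltnW (leq_trans (hS j) (proj2 (hg _)))).
exists (fun k => g (h k)); split=> [i|i j ne [f /bij_eq_card e _]]; first exact: (hg _).1.
by case: (ltngtP i j) => [/incr|/incr|//]; rewrite e ltnn.
Qed.

Definition is_system (A : system) :=
  A = chain_system \/ exists (F : pattern_family) b, F \in families /\ A = fam_system F b.

Lemma has_systems (P : pred system) :
  has P systems <-> exists A, is_system A /\ P A.
Proof.
split.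
  have hasIn (s : seq system) : has P s -> exists A, List.In A s /\ P A.
    elim: s => //= B s ih /orP[PB|/ih[A [sA PA]]]; first by exists B; split; [left|].
    by exists A; split; [right|].
  have fam (A : system) (s : seq pattern_family) :
      List.In A [seq fam_system F b | F <- s, b <- [:: false; true]] ->
      exists (F : pattern_family) b, F \in s /\ A = fam_system F b.
    elim: s => //= F s ih [<-|[<-|/ih[F' [b [sF ->]]]]].
    + by exists F, false; rewrite mem_head.
    + by exists F, true; rewrite mem_head.
    + by exists F', b; rewrite in_cons sF orbT.
  by case/hasIn=> A [[<-|hA] PA]; [exists chain_system | exists A]; split=> //;
    [left | right; apply: (fam _ families)].
have inHas A (s : seq system) : List.In A s -> P A -> has P s.
  by elim: s => //= B s ih [->|/ih h] => [->|/h ->]; rewrite ?orbT.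
move=> [A [hA PA]]; apply: inHas PA; case: hA => [->|[F [b [hF ->]]]]; [by left|right].
elim: families hF => // F' s ih; rewrite in_cons => /orP[/eqP <-|/ih h] /=.
  by case: b {ih}; [right; left | left].
by do 2 right.
Qed.

Lemma system_small_letters A : is_system A -> small_letters A.
Proof.
have test : all (fun F => all (fun b => small_letters (fam_system F b)) [:: false; true]) families.
  by [].
move=> [->//|[F [b [hF ->]]]]; have /allP := allP test F hF; apply.
by case: b; rewrite !inE.
Qed.

(** Every letter has exactly one successor in [follows], and the first letter is 0. *)
Lemma fam_walk_unique F b w : (forall n, walk (fam_system F b) n w) -> w =1 fam_word F.1.1.
Proof.
case: F => [[r D] s] hw i; rewrite [_.1.1]/=.
elim: i => [|i ih].
  have /walkP[-> _] := hw 0; rewrite /fam_word; case: (posnP r) => [->//|//].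
have /walkP[_ /(_ i (ltnSn i))] := hw i.+1; rewrite ih.
change ((fam_word r i, w i.+1) \in (r.+1, r) :: [seq (i, i.+1) | i <- iota 0 r.+1] ->
  w i.+1 = fam_word r i.+1).
rewrite in_cons => /orP[/eqP[]|/mapP[j]].
  by rewrite /fam_word; case: ltnP => hi; [lia|]; case: ltnP; lia.
rewrite mem_iota => hj []; rewrite /fam_word.
by case: ltnP => hi; case: ltnP; lia.
Qed.

Lemma free_walks_infinite A L : is_system A -> (exists w, forall n, free_walk A n L w) ->
  infinitely_many_up_to_iso (fun G => Free (fun H => List.In H L) G /\ prime_graph G).
Proof.
move=> sA [w hw]; apply: infinitely_manyP => n.
have ww m : walk A m w by case/andP: (hw m).
suff [k [len [hlen pw]]] : exists k len, n <= len /\ prime_word A (fun i => w (k + i)) len.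
  exists (word_graph A (fun i => w (k + i)) len); rewrite card_word_graph; split=> //; split.
    exact: free_word_graph (hw (k + len)) (leqnn _).
  exact: prime_word_graph.
case: sA => [eA|[F [b [hF eA]]]]; subst A.
  (* The summand 10 makes the chain long enough for the window lemma and covers the loss of at most
     three vertices. *)
  have [i|k [len [h1 h2 pw]]] := @chain_prime_window w (n + 10) ltac:(lia).
    case: i => [|i]; first by case/walkP: (ww 0) => ->.
    by case/walkP: (ww i.+1) => _ /(_ i (ltnSn i)); rewrite !inE => /or4P[] /eqP[_ ->].
  by exists k, len; split=> //; lia.
exists 0, (F.1.1 + (n + 3).*2); split; first by lia.
have := @families_prime F b (n + 3) hF ltac:(lia).
have e i j : wadj (fam_system F b) (fun i => w (0 + i)) i j =
    wadj (fam_system F b) (fam_word F.1.1) i j.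
  apply: (@eq_wadj _ _ _ (i + j)); rewrite ?leq_addr ?leq_addl // => k _.
  exact: (fam_walk_unique ww).
by move=> pw X cX; apply: pw => v a c hv ha hc nv Xa Xc; rewrite -!e; apply: cX.
Qed.

(** * Unavoidable words in prime graphs *)

Section Complement.
Variable G : sgraph.

Definition co_edge : rel G := fun x y => (x != y) && ~~ edge x y.

Lemma co_edge_sym : symmetric co_edge.
Proof. by move=> x y; rewrite /co_edge eq_sym edge_sym. Qed.

Lemma co_edge_irrefl : irreflexive co_edge.
Proof. by move=> x; rewrite /co_edge eqxx. Qed.

Definition co : sgraph := SGraph co_edge_sym co_edge_irrefl.

Lemma co_edgeE (x y : G) : x != y -> @edge co x y = ~~ edge x y.
Proof. by rewrite /edge /= /co_edge => ->. Qed.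

Lemma prime_co : prime_graph G -> prime_graph co.
Proof.
move=> pG [X [cX hX]]; apply: pG; exists X; split=> // v vX.
have ne x : x \in X -> v != x by move=> xX; apply: contraNneq vX => ->.
case: (hX v vX) => h; [right|left] => x xX; have := h x xX; rewrite co_edgeE ?ne //.
by rewrite negbK.
Qed.
End Complement.

(** Injectivity of [f] on the positions concerned follows from [prime_word_inj] once [n >= 3]. *)
Definition contains_family n (G : sgraph) := exists F b, F \in families /\
  exists f : nat -> G, forall i j, i < j -> j < F.1.1 + n.*2 ->
    edge (f i) (f j) = wadj (fam_system F b) (fam_word F.1.1) i j.

Lemma contains_family_leq m n G : m <= n -> contains_family n G -> contains_family m G.
Proof.
move=> mn [F [b [hF [f hf]]]]; exists F, b; split=> //; exists f => i j ij jm.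
by apply: hf => //; lia.
Qed.

(* A repeated vertex would make two letters of a prime word twins. *)
Lemma prime_word_inj (G : sgraph) A w len (f : nat -> G) : 2 < len -> prime_word A w len ->
  (forall i j, i < j -> j < len -> edge (f i) (f j) = wadj A w i j) ->
  forall i j, i < j -> j < len -> f i != f j.
Proof.
move=> len2 pw hf i j ij jl; apply/negP => /eqP eij.
have hf' p q : p < len -> q < len -> edge (f p) (f q) = wadj A w p q.
  move=> hp hq; case: (ltngtP p q) => [lt|lt|->]; first exact: hf.
    by rewrite edge_sym wadj_sym hf.
  by rewrite edge_irrefl wadj_irr.
have cX : module_closed A w len (fun k => (k == i) || (k == j)).
  move=> v a b hv ha hb _ /orP[]/eqP ea /orP[]/eqP eb;
  by rewrite -!hf' // ea eb ?eij.
have full v : v < len -> (v == i) || (v == j).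
  apply: (pw _ cX i j); rewrite ?eqxx ?orbT //; last by rewrite (ltn_eqF ij).
  exact: ltn_trans jl.
by move: (full 0) (full 1) (full 2) ij; lia.
Qed.

Lemma wadj_flip F b w i j : i != j ->
  wadj (fam_system F (~~ b)) w i j = ~~ wadj (fam_system F b) w i j.
Proof.
move=> ne; have E n x y : ladj (fam_system F (~~ b)) n x y = ~~ ladj (fam_system F b) n x y.
  by case: F => [[r D] s]; rewrite /ladj /= -addNb.
by rewrite /wadj !E; case: ltngtP ne.
Qed.

Lemma contains_family_co n G : 3 <= n -> contains_family n (co G) -> contains_family n G.
Proof.
move=> n3 [F [b [hF [f hf]]]]; exists F, (~~ b); split=> //; exists f => i j ij jn.
have ne := prime_word_inj _ (families_prime (b := b) hF n3) hf ij jn.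
rewrite wadj_flip -?hf ?(ltn_eqF ij) //.
by rewrite co_edgeE ?negbK // ne //; lia.
Qed.

Lemma ladj_far F b x y : ladj (fam_system F b) false x y = b (+) ((x, y) \in F.1.2).
Proof. by case: F => [[]]. Qed.

Lemma ladj_near F b : ladj (fam_system F b) true F.1.1 F.1.1.+1 = b (+) F.2.
Proof.
case: F => [[r D] s].
change (b (+) ((r, r.+1) \in [seq p <- (r, r.+1) :: D | (p != (r, r.+1)) || s]) = b (+) s).
by rewrite mem_filter in_cons !eqxx andbT.
Qed.

Section Realize.
Variables (G : sgraph) (F : pattern_family) (n : nat) (cs A B : nat -> G).
Let r := F.1.1.
Let D x y := (x, y) \in F.1.2.

(** [cs] lists the single vertices, and [A k], [B k] are the two vertices of block [k]. Thus
    position [p >= r] lies in block [(p - r)./2], and its parity selects [A] or [B]. *)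
Lemma realize : F \in families ->
  (forall i j, i < j -> j < r -> edge (cs i) (cs j) = D i j) ->
  (forall i k, i < r -> k < n ->
    edge (cs i) (A k) = D i r /\ edge (cs i) (B k) = D i r.+1) ->
  (forall i j, i < j -> j < n ->
    [/\ edge (A i) (A j) = D r r, edge (A i) (B j) = D r r.+1,
        edge (B i) (A j) = D r.+1 r & edge (B i) (B j) = D r.+1 r.+1]) ->
  (forall i, i < n -> edge (A i) (B i) = F.2) ->
  contains_family n G.
Proof.
move=> hF hcc hc hab hm; exists F, false; split=> //.
exists (fun p => if p < r then cs p else (if odd (p - r) then B else A) (p - r)./2).
move=> p q pq; rewrite -/r => hq; rewrite wadj_lt // /fam_word -/r.
case: (ltnP q r) => qr.
  rewrite (ltn_trans pq qr) hcc // ladj_fam // -/r xpair_eqE.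
  by rewrite (ltn_eqF (ltn_trans pq qr)).
case: (ltnP p r) => pr.
  have hk : (q - r)./2 < n by lia.
  have [hA hB] := hc p (q - r)./2 pr hk.
  rewrite ladj_fam -/r ?xpair_eqE ?(ltn_eqF pr) //.
  by case: (odd (q - r)); rewrite ?addn1 ?addn0.
have [lt|ge] := ltnP (p - r)./2 (q - r)./2.
  have [h1 h2 h3 h4] := hab _ _ lt ltac:(lia).
  (* Consecutive positions in different blocks carry the letters [r.+1], [r], for which [near] and
     [far] agree. *)
  have ne : (r + odd (p - r), r + odd (q - r)) != (r, r.+1) \/ (q == p.+1) = false.
    case: (boolP (q == p.+1)) => [/eqP eq|_]; [left|by right].
    have eqr : q - r = (p - r).+1 by rewrite eq subSn.
    move: lt; rewrite eqr /= uphalf_half; case: (odd (p - r)); last by rewrite ltnn.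
    by rewrite addn1 xpair_eqE (gtn_eqF (ltnSn r)).
  have -> : ladj (fam_system F false) (q == p.+1) (r + odd (p - r)) (r + odd (q - r)) =
            D (r + odd (p - r)) (r + odd (q - r)).
    case: ne => [ne|->]; first by rewrite ladj_fam.
    by rewrite ladj_far.
  by case: (odd (p - r)); case: (odd (q - r)); rewrite ?addn1 ?addn0.
have [op oq eh eq] : [/\ ~~ odd (p - r), odd (q - r), (p - r)./2 = (q - r)./2 & q = p.+1].
  move: (odd_double_half (p - r)) (odd_double_half (q - r)) ge pq pr.
  by case: (odd (p - r)); case: (odd (q - r)) => /=; split => //; lia.
rewrite (negPf op) oq -eh hm ?eq ?eqxx; last by lia.
by rewrite addn0 addn1 ladj_near.
Qed.
End Realize.

(** * Reaching vertices by successive splitting *)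

Section Levels.
Variable G : sgraph.
Implicit Types (B : {set G}) (v z : G).

Definition splits z B := [exists a in B, exists b in B, edge z a && ~~ edge z b].

Lemma splitsP z B : reflect
  (exists a b, [/\ a \in B, b \in B, edge z a & ~~ edge z b]) (splits z B).
Proof.
apply: (iffP existsP) => [[a /andP[aB /existsP[b /and3P[bB za zb]]]]|[a [b [aB bB za zb]]]].
  by exists a, b.
by exists a; rewrite aB; apply/existsP; exists b; rewrite bB za.
Qed.

Lemma nsplits z B a b : ~~ splits z B -> a \in B -> b \in B -> edge z a = edge z b.
Proof.
move=> ns aB bB; case za: (edge z a); case zb: (edge z b) => //; case/splitsP: ns.
  by exists a, b; rewrite zb.
by exists b, a; rewrite za.
Qed.

Lemma splits_neq z B a b : a \in B -> b \in B -> edge z a != edge z b -> splits z B.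
Proof.
move=> aB bB ne; apply/splitsP; move: ne.
by case za: (edge z a); case zb: (edge z b) => // _; [exists a, b | exists b, a];
  rewrite ?za ?zb.
Qed.

(** These are the ways along which arguments proceed: each vertex splits the set of [B] and all
    preceding vertices. *)
Fixpoint reach B (zs : seq G) : bool :=
  if zs is z :: zs' then [&& z \notin B, splits z B & reach (z |: B) zs'] else true.

Lemma reach_rcons B zs z : reach B (rcons zs z) =
  [&& reach B zs, z \notin B :|: [set x in zs] & splits z (B :|: [set x in zs])].
Proof.
elim: zs B => [|y zs ih] B /=.
  have -> : B :|: [set x in [::]] = B by apply/setP => x; rewrite !inE orbF.
  by rewrite andbT.
have -> : B :|: [set x in y :: zs] = (y |: B) :|: [set x in zs].
  by apply/setP => x; rewrite !inE orbCA orbA.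
by rewrite ih !andbA.
Qed.

Definition level B k := iter k (fun X => X :|: [set v | splits v X]) B.

Lemma level_sub B k l : k <= l -> level B k \subset level B l.
Proof.
elim: l => [|l ih]; first by rewrite leqn0 => /eqP ->.
rewrite leq_eqVlt => /orP[/eqP -> //|/ih h]; exact: subset_trans h (subsetUl _ _).
Qed.

(** A proper level that equals the next one is split by no outside vertex and would be a homogeneous
    set. So level [k] has at least [k + 2] vertices as long as the levels are proper. *)
Lemma prime_level B : prime_graph G -> 1 < #|B| -> exists k, level B k = [set: G].
Proof.
move=> pG B1; exists #|G|; apply/eqP; rewrite -subTset; apply/negPn/negP => nT.
suff : #|G|.+2 <= #|level B #|G| | by rewrite ltnNge ltnW // ltnS max_card.
have {}nT k : k <= #|G| -> ~~ ([set: G] \subset level B k).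
  by move=> hk; apply: contra nT => h; apply: subset_trans h (level_sub _ hk).
elim: {-2}#|G| (leqnn #|G|) => // k ih hk; have {}ih := ih (ltnW hk).
apply: leq_ltn_trans ih _; apply: proper_card; rewrite properE level_sub //=.
apply/negP => stable; apply: pG; exists (level B k); split.
  rewrite (leq_trans B1) ?subset_leq_card ?(level_sub B (leq0n k)) //=.
  by rewrite -cardsT; apply: proper_card; rewrite properE subsetT nT // ltnW.
move=> v vN; have [a aB] : exists a, a \in level B k.
  by have /card_gt1P[a [b [aB _ _]]] := B1; exists a; apply: subsetP (level_sub B (leq0n k)) a aB.
have ns : ~~ splits v (level B k).
  by apply: contra vN => sv; apply: (subsetP stable); rewrite !inE sv orbT.
case va: (edge v a); [left|right] => x xB; by rewrite (nsplits ns xB aB) va.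
Qed.

(** As [v] is not in level [k.+1], it does not split level [k]. It does split level [k.+1], so some
    vertex new there has the other adjacency to [v]. *)
Lemma level_pred B a v k : a \in B -> v \in level B k.+2 -> v \notin level B k.+1 ->
  exists u, [/\ u \in level B k.+1, u \notin level B k, edge v u != edge v a &
    forall x, x \in level B k -> edge v x = edge v a].
Proof.
move=> aB; rewrite [level B k.+2]/= -/(level B k.+1) !inE => /orP[->//|sv].
rewrite -/(level _ _) negb_or => /andP[_ ns].
have aR : a \in level B k by apply: subsetP (level_sub B (leq0n k)) a aB.
have hx x : x \in level B k -> edge v x = edge v a by move=> h; apply: nsplits ns _ _.
have [u uR ne] : exists2 u, u \in level B k.+1 & edge v u != edge v a.
  case/splitsP: sv => x [y [xR yR vx vy]].
  by case va: (edge v a); [exists y | exists x]; rewrite ?(negPf vy) ?vx.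
by exists u; split=> //; apply: contra ne => /hx ->.
Qed.

(** Predecessors are followed down the levels; each next vertex distinguishes its predecessor from
    [a] in [B]. *)
Lemma level_reach B v k : 0 < #|B| -> v \in level B k.+1 -> v \notin level B k ->
  exists zs, [/\ size zs = k.+1, reach B zs, v \in zs & {subset zs <= level B k.+1}].
Proof.
move=> /card_gt0P[a aB]; elim: k v => [|k ih] v vR nv.
  exists [:: v]; split=> //=; [|by rewrite mem_head|by move=> x; rewrite inE => /eqP->].
  by move: vR nv; rewrite /level /= !inE => /orP[->|->] // ->.
have [u [uR nu ne _]] := level_pred aB vR nv.
have [zs [sz rz uz sub]] := ih u uR nu.
exists (rcons zs v); split; rewrite ?size_rcons ?sz ?mem_rcons ?mem_head //.
  rewrite reach_rcons rz !inE negb_or /=; apply/andP; split.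
    apply/andP; split; [|by apply: contra nv; apply: sub].
    by apply: contra nv; apply: (subsetP (level_sub B (leq0n k.+1))).
  by apply: splits_neq ne; rewrite !inE ?uz ?aB ?orbT.
move=> x; rewrite mem_rcons inE => /orP[/eqP -> //|/sub].
by apply: subsetP (level_sub B (leqnSn _)) x.
Qed.

(* Within a shortest way from [B] to [v], each vertex splits the previous level but not the one
   before: it is uniform on the latter and has the opposite adjacency to the previous vertex. *)
Lemma level_chain B a v k : a \in B -> v \in level B k.+1 -> v \notin level B k ->
  exists (f : nat -> G) (e : nat -> bool), [/\ f k.+1 = v,
    forall i, i <= k.+1 -> f i \in level B i &
    forall i j, i < j -> j <= k.+1 -> edge (f i) (f j) = (j == i.+1) (+) e j].
Proof.
move=> aB; elim: k v => [|k ih] v vR nv.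
  exists (fun i => if i is 0 then a else v), (fun=> ~~ edge a v); split=> //.
    by case=> [|[|]].
  by case=> [|i] [|[|j]] // _ _; rewrite addbN negbK.
have [u [uR nu ne hx]] := level_pred aB vR nv.
have [f [e [fu fR fe]]] := ih u uR nu.
exists (fun i => if i <= k.+1 then f i else v), (fun j => if j <= k.+1 then e j else edge v a).
split; first by rewrite ltnn.
  move=> i; rewrite leq_eqVlt => /orP[/eqP ->|]; first by rewrite ltnn.
  by rewrite ltnS => hi; rewrite hi fR.
move=> i j ij; rewrite leq_eqVlt => /orP[/eqP ej|]; last first.
  by rewrite ltnS => jk; rewrite jk (leq_trans (ltnW ij) jk) fe.
rewrite ej ltnn; have ik : i <= k.+1 by rewrite -ltnS -ej.
rewrite ik edge_sym eqSS; case: (eqVneq k.+1 i) => [<-|ni].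
  by rewrite fu; move: ne; case: (edge v u); case: (edge v a).
rewrite hx //; apply: (subsetP (level_sub B _)) (fR i ik).
by move: ik; rewrite leq_eqVlt eq_sym (negPf ni).
Qed.

Definition chain_of_length t := exists w (f : nat -> G),
  [/\ w 0 = 0, forall i, w i < 2, injective (fun i : 'I_t.+1 => f i) &
    forall i j, i < j -> j <= t -> edge (f i) (f j) = wadj chain_system w i j].

Definition separable t := forall a b v : G, a != b ->
  exists zs, [/\ size zs <= t, reach [set a; b] zs & (v \in [set a; b]) || (v \in zs)].

(** If level [t] of every pair is everything, [level_reach] gives ways of length at most [t].
    Otherwise some vertex first appears beyond level [t], and [level_chain] turns its way into a
    chain. *)
Lemma chain_or_separable t : prime_graph G -> chain_of_length t \/ separable t.
Proof.
move=> pG.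
have [all_low|] := boolP [forall a : G, forall b, forall v, (a != b) ==> (v \in level [set a; b] t)].
  right=> a b v ne; have /forallP/(_ b)/forallP/(_ v) := forallP all_low a.
  rewrite ne /= => vt; have ex : exists k, v \in level [set a; b] k by exists t.
  have [[|k] vk kmin] := ex_minnP ex; first by exists [::]; rewrite orbF.
  have nv : v \notin level [set a; b] k by apply/negP => /kmin; rewrite ltnn.
  have [|zs [sz rz vz _]] := level_reach _ vk nv; first by rewrite cards2.
  by exists zs; rewrite sz vz orbT; split=> //; apply: kmin.
rewrite !negb_forall => /existsP[a]; rewrite negb_forall => /existsP[b].
rewrite negb_forall => /existsP[v]; rewrite negb_imply => /andP[ne nv]; left.
have B1 : 1 < #|[set a; b]| by rewrite cards2 ne.
have [K hK] := prime_level pG B1.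
have ex : exists k, v \in level [set a; b] k by exists K; rewrite hK inE.
have [k vk kmin] := ex_minnP ex.
have tk : t < k by rewrite ltnNge; apply: contra nv => kt; apply: subsetP (level_sub _ kt) v vk.
case: k tk vk kmin {ex} => // k tk vk kmin.
have nvk : v \notin level [set a; b] k by apply/negP => /kmin; rewrite ltnn.
have [f [e [_ fR fe]]] := level_chain (set21 a b) vk nvk.
pose w i := if i is 0 then 0 else e i : nat.
have w2 i : w i < 2 by rewrite /w; case: i => // i; case: (e _).
have fw i j : i < j -> j <= k.+1 -> edge (f i) (f j) = wadj chain_system w i j.
  move=> ij jk; rewrite fe // wadj_lt // ladj_chain //; congr (_ (+) _).
  by case: j ij jk => // j _ _; rewrite /w; case: (e _).
exists w, f; split=> // [i j|i j ij jt]; last by apply: fw => //; lia.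
wlog ij : i j / i < j.
  move=> sym eij; case: (ltngtP i j) => [lt|lt|/val_inj //]; first exact: sym.
  by apply/esym/sym.
move=> eij; have jt : j <= t by rewrite -ltnS.
(* Equal vertices [f i], [f j] are told apart by [f j.+1], for which only [f j] is the predecessor;
   it exists since the chain goes beyond [t]. *)
have := fw j j.+1 (ltnSn _) ltac:(lia); have := fw i j.+1 ltac:(lia) ltac:(lia).
rewrite eij => ->; rewrite !wadj_lt ?ladj_chain //; last by lia.
have -> : (j.+1 == i.+1) = false by lia.
by rewrite eqxx; case: (_ == 1).
Qed.

End Levels.

(** * Ramsey's theorem for sequences *)

Lemma pigeonhole_count (C : finType) (T : Type) (f : T -> C) k s :
  #|C| * k < size s -> exists c, k < count (fun x => f x == c) s.
Proof.
move=> h; apply/existsP; apply: contraLR h; rewrite negb_exists -leqNgt => /forallP h.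
have -> : size s = \sum_c count (fun x => f x == c) s.
  elim: s {h} => [|x s ih] /=; first by rewrite big1.
  by rewrite big_split /= -ih (bigD1 (f x)) //= eqxx big1 // => c; rewrite eq_sym => /negPf ->.
rewrite -sum_nat_const; apply: leq_sum => c _; by rewrite leqNgt.
Qed.

Section Ramsey.
Variable C : finType.

(** Keeping the most frequent colour seen from the first element makes the colour of a pair depend
    on its earlier element only; each element is stored with that colour. *)
Lemma end_homogeneous n : exists M, forall (T : eqType) (col : T -> T -> C) s, M <= size s ->
  exists t : seq (T * C), [/\ size t = n, subseq (unzip1 t) s &
    pairwise (fun p q => col p.1 q.1 == p.2) t].
Proof.
elim: n => [|n [M ih]]; first by exists 0 => T col s _; exists [::]; rewrite sub0seq.
exists (#|C| * M).+2 => T col [//|x s] /= hs.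
have [c hc] := @pigeonhole_count C T (col x) M s hs.
have [|t [st sub pw]] := ih T col [seq y <- s | col x y == c]; first by rewrite size_filter ltnW.
exists ((x, c) :: t); split; rewrite /= ?st ?eqxx ?pw ?andbT //.
  exact: subseq_trans sub (filter_subseq _ _).
apply/allP => p pt; have := mem_subseq sub (map_f fst pt).
by rewrite mem_filter => /andP[].
Qed.

(** A frequent colour among those stored by [end_homogeneous] selects the monochromatic subsequence.
    Pairs are taken in the order of the sequence, so [col] may be asymmetric. *)
Lemma ramsey (c0 : C) n : exists M, forall (T : eqType) (col : T -> T -> C) s, M <= size s ->
  exists t c, [/\ subseq t s, size t = n & pairwise (fun x y => col x y == c) t].
Proof.
have [M hM] := end_homogeneous (#|C| * n).+1.
exists M => T col s /(hM T col)[t [st sub pw]].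
have [|c hc] := @pigeonhole_count C (T * C)%type snd n t; first by rewrite st.
pose u := [seq p.1 | p <- t & p.2 == c].
have tu : subseq (take n u) u := take_subseq u n.
exists (take n u), c; split.
- apply: subseq_trans tu (subseq_trans _ sub); exact: map_subseq (filter_subseq _ _).
- by rewrite size_takel // size_map size_filter ltnW.
apply: (subseq_pairwise tu); rewrite pairwise_map.
apply: (@sub_in_pairwise _ [pred p | p.2 == c] (fun p q => col p.1 q.1 == p.2)).
- by move=> p q /eqP <-.
- exact: filter_all.
exact: subseq_pairwise (filter_subseq _ _) pw.
Qed.
End Ramsey.

Lemma pairwise_nth (T : Type) (r : rel T) x0 s i j : pairwise r s ->
  i < j -> j < size s -> r (nth x0 s i) (nth x0 s j).
Proof. by move=> /(pairwiseP x0) h ij js; apply: h => //; apply: ltn_trans js. Qed.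

Lemma pairwise_mkseq (T : Type) (r : rel T) (f : nat -> T) k :
  (forall i j, i < j -> j < k -> r (f i) (f j)) -> pairwise r (mkseq f k).
Proof.
move=> h; case: k h => // k h; apply/(pairwiseP (f 0)) => i j.
rewrite !inE size_mkseq => hi hj ij; rewrite !nth_mkseq //; exact: h.
Qed.

(** * Families from stable sets, threshold graphs and induced matchings *)

Section Unavoidable.
Implicit Type G : sgraph.

Lemma prime_splits G (B : {set G}) : prime_graph G -> 1 < #|B| < #|G| ->
  exists2 z, z \notin B & splits z B.
Proof.
move=> pG cB; case: (boolP [exists z, (z \notin B) && splits z B]).
  by case/existsP=> z /andP[zB sz]; exists z.
rewrite negb_exists => /forallP h; case: pG; exists B; split=> // v vB.
have := h v; rewrite vB /= => ns; have /andP[/card_gt1P[a [_ [aB _ _]]] _] := cB.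
case va: (edge v a); [left|right] => x xB; by rewrite (nsplits ns xB aB) va.
Qed.

(** Some outside vertex [z] splits the first two vertices. The larger side of [s] with respect to
    [z] is kept, and [z] is paired with a vertex of the other side; each round halves [s]. *)
Lemma trace_pairs G m (s : seq G) : prime_graph G -> 2 < #|G| -> uniq s -> 2 ^ m <= size s ->
  exists t : seq (G * G), [/\ size t = m, {subset unzip1 t <= s} &
    pairwise (fun p q => edge p.2 q.1 != edge p.2 p.1) t].
Proof.
move=> pG G2; elim: m s => [|m ih] s us hs; first by exists [::].
have s2 : 1 < size s by apply: leq_trans hs; rewrite expnS; have := expn_gt0 2 m; lia.
case: s us hs s2 => [|x [|y s]] // us hs _.
have xy : x != y by move: us => /=; rewrite inE negb_or => /andP[/andP[]].
have [z zB /splitsP[a [b [aB bB za zb]]]] : exists2 z, z \notin [set x; y] & splits z [set x; y].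
  by apply: prime_splits => //; rewrite cards2 xy.
set s' := x :: y :: s in us hs *.
have sub u : u \in [set x; y] -> u \in s' by rewrite !inE => /orP[]->; rewrite ?orbT.
have szs : size [seq u <- s' | edge z u] + size [seq u <- s' | ~~ edge z u] = size s'.
  by rewrite !size_filter -(count_predC (edge z)).
have go (e : bool) u : u \in s' -> edge z u = ~~ e -> 2 ^ m <= size [seq u <- s' | edge z u == e] ->
    exists t : seq (G * G), [/\ size t = m.+1, {subset unzip1 t <= s'} &
    pairwise (fun p q => edge p.2 q.1 != edge p.2 p.1) t].
  move=> us' zu; case/ih => [|t [st tsub pw]]; first exact: filter_uniq.
  exists ((u, z) :: t); split=> /=; rewrite ?st ?pw ?andbT //.
    by move=> q; rewrite inE => /orP[/eqP -> //|/tsub]; rewrite mem_filter => /andP[].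
  apply/allP => p pt; have := tsub _ (map_f fst pt).
  by rewrite mem_filter zu => /andP[/eqP ->]; case: (e).
move: hs; rewrite -szs expnS mul2n -addnn => hs.
have [h|h] : 2 ^ m <= size [seq u <- s' | edge z u] \/ 2 ^ m <= size [seq u <- s' | ~~ edge z u].
  by lia.
- apply: (go true b) => //; [exact: sub | exact/negbTE|].
  by apply: leq_trans h _; rewrite !size_filter; apply/eq_leq/eq_count => u; rewrite eqb_id.
- apply: (go false a) => //; first exact: sub.
  by apply: leq_trans h _; rewrite !size_filter; apply/eq_leq/eq_count => u; rewrite eqbF_neg.
Qed.

Definition threshold n G := exists A B : nat -> G,
  (forall i, i < n -> edge (A i) (B i)) /\
  forall i j, i < j -> j < n ->
    [/\ edge (A i) (A j), edge (A i) (B j), edge (B i) (A j) = false & edge (B i) (B j) = false].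

Definition matching n G := exists A B : nat -> G,
  (forall i, i < n -> edge (A i) (B i)) /\
  forall i j, i < j -> j < n ->
    [/\ edge (A i) (A j) = false, edge (A i) (B j) = false, edge (B i) (A j) = false &
        edge (B i) (B j) = false].

Lemma realize0 G n D s (A B : nat -> G) : (0, D, s) \in families ->
  (forall i j, i < j -> j < n ->
    [/\ edge (A i) (A j) = ((0, 0) \in D), edge (A i) (B j) = ((0, 1) \in D),
        edge (B i) (A j) = ((1, 0) \in D) & edge (B i) (B j) = ((1, 1) \in D)]) ->
  (forall i, i < n -> edge (A i) (B i) = s) ->
  contains_family n G.
Proof. by move=> hF h1 h2; apply: (@realize G (0, D, s) n A A B). Qed.

(* [y i] separates [x i] from all later [x j]; Ramsey makes the other adjacencies uniform. *)
Lemma stable_patterns n : exists M, forall G (s : seq G), prime_graph G -> 2 < #|G| ->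
  uniq s -> pairwise (fun x y => ~~ edge x y) s -> M <= size s ->
  [\/ contains_family n G, matching n G | threshold n G].
Proof.
(* Two indices more than [n]: the adjacency of [y i] and [x i] is read off the pair [i], [i.+1], and
   some cases shift [x] by one. *)
have [M hM] := ramsey (true, true, true) n.+2.
exists (2 ^ M) => G s pG G2 us st hs.
have st' x y : x \in s -> y \in s -> edge x y = false.
  move=> xs ys; case: (eqVneq x y) => [->|ne]; first exact: edge_irrefl.
  have hxy u v : u \in s -> v \in s -> index u s < index v s -> edge u v = false.
    move=> us' vs lt; have := pairwise_nth x st lt; rewrite index_mem vs => /(_ isT).
    by rewrite !nth_index // => /negPf.
  case: (ltngtP (index x s) (index y s)) => [/hxy|/hxy h|e]; first exact.
    by rewrite edge_sym h.
  by move: ne; rewrite -(nth_index x xs) -(nth_index x ys) e eqxx.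
have [t [szt tsub pt]] := trace_pairs pG G2 us hs.
have [|r [[[e d] g] [rt szr pr]]] := hM _ (fun p q : G * G =>
  (edge p.2 p.1, edge q.2 p.1, edge p.2 q.2)) t; first by rewrite szt.
have x0 : G by case: (s) hs => [|x ?] //; rewrite leqn0 expn_eq0.
pose x i := (nth (x0, x0) r i).1; pose y i := (nth (x0, x0) r i).2.
have hx i : i < n.+2 -> x i \in s.
  move=> hi; apply: tsub; apply: (mem_subseq (map_subseq fst rt)).
  by apply: map_f; apply: mem_nth; rewrite szr.
have hcol i j : i < j -> j < n.+2 ->
    [/\ edge (y i) (x i) = e, edge (y j) (x i) = d, edge (y i) (y j) = g &
        edge (y i) (x j) = ~~ e].
  move=> ij jn; have := pairwise_nth (x0, x0) pr ij; rewrite szr => /(_ jn) /eqP[<- <- <-].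
  have := pairwise_nth (x0, x0) (subseq_pairwise rt pt) ij; rewrite szr => /(_ jn).
  by move=> h; split=> //; move: h; rewrite /y /x; do 2 case: edge.
have hxx i j : i <= n -> j <= n -> edge (x i) (x j) = false.
  by move=> hi hj; apply: st'; apply: hx; apply: leqW.
have hyx i j : i <= n -> j <= n ->
    edge (y i) (x j) = if i < j then ~~ e else if j < i then d else e.
  move=> hi hj; case: ltngtP => [ij|ji|<-]; last by case: (hcol i i.+1 (ltnSn i) hi).
    by case: (hcol i j ij (leqW hj)).
  by case: (hcol j i ji (leqW hi)).
have hyy i j : i < j -> j <= n -> edge (y i) (y j) = g.
  by move=> ij jn; case: (hcol i j ij (leqW jn)).
have hxy i j : i <= n -> j <= n ->
    edge (x i) (y j) = if j < i then ~~ e else if i < j then d else e.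
  by move=> hi hj; rewrite edge_sym hyx.
clear - hxx hyx hyy hxy.
case: e d g hyx hyy hxy => [] [] [] hyx hyy hxy.
(* Here [y i] sees [x j] exactly for [j <= i], so the order is reversed. *)
- apply: Or33; exists (fun i => y (n - i)), (fun i => x (n - i)); split=> [i hi|i j ij jn].
    by rewrite hyx ?ltnn // leq_subr.
  have lt : n - j < n - i by lia.
  by rewrite edge_sym hyy ?leq_subr // !hyx ?hxy ?hxx ?leq_subr // ltnNge (ltnW lt) lt.
- apply: Or31; apply: (@realize0 _ _ [:: (0, 1)] true x y) => // [i j ij jn|i hi].
    have hi := ltn_trans ij jn.
    by rewrite hxx ?hxy ?hyx ?hyy ?ij ?(ltnW hi) ?(ltnW jn) // ltnNge (ltnW ij).
  by rewrite hxy ?ltnn // ltnW.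
- apply: Or31; apply: (@realize0 _ _ [:: (1, 1)] true x y) => // [i j ij jn|i hi].
    have hi := ltn_trans ij jn.
    by rewrite hxx ?hxy ?hyx ?hyy ?ij ?(ltnW hi) ?(ltnW jn) // ltnNge (ltnW ij).
  by rewrite hxy ?ltnn // ltnW.
- apply: Or32; exists x, y; split=> [i hi|i j ij jn]; first by rewrite hxy ?ltnn // ltnW.
  have hi := ltn_trans ij jn.
  by rewrite hxx ?hxy ?hyx ?hyy ?ij ?(ltnW hi) ?(ltnW jn) // ltnNge (ltnW ij).
- apply: Or31; apply: (@realize0 _ _ [:: (1, 1); (0, 1); (1, 0)] false x y) => // [i j ij jn|i hi].
    have hi := ltn_trans ij jn.
    by rewrite hxx ?hxy ?hyx ?hyy ?ij ?(ltnW hi) ?(ltnW jn) // ltnNge (ltnW ij).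
  by rewrite hxy ?ltnn // ltnW.
- apply: Or31; apply: (@realize0 _ _ [:: (0, 1); (1, 0)] false x y) => // [i j ij jn|i hi].
    have hi := ltn_trans ij jn.
    by rewrite hxx ?hxy ?hyx ?hyy ?ij ?(ltnW hi) ?(ltnW jn) // ltnNge (ltnW ij).
  by rewrite hxy ?ltnn // ltnW.
(* Here [y i] sees [x j] exactly for [i < j]; shifting [x] turns this into [i <= j]. *)
- apply: Or33; exists y, (fun i => x i.+1); split=> [i hi|i j ij jn].
    by rewrite hyx ?ltnSn // ltnW.
  have hi := ltn_trans ij jn.
  rewrite hyy ?(ltnW jn) // !hyx ?hxy ?hxx ?(ltnW hi) ?(ltnW jn) // !ltnS (ltnW ij) leqNgt ij.
  by split=> //; case: ifP.
- apply: Or31; apply: (@realize0 _ _ [:: (0, 1)] true y (fun i => x i.+1)) => // [i j ij jn|i hi].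
    have hi := ltn_trans ij jn.
    rewrite hyy ?(ltnW jn) // !hyx ?hxy ?hxx ?(ltnW hi) ?(ltnW jn) // !ltnS (ltnW ij) leqNgt ij.
    by split=> //; case: ifP.
  by rewrite hyx ?ltnSn // ltnW.
Qed.


Definition nested G (p q : G * G) : bool :=
  [&& edge p.1 q.1, edge p.1 q.2, ~~ edge p.2 q.1 & ~~ edge p.2 q.2].

(* All vertices of [K] see the threshold sequence like a vertex of its stable side placed after
   everything else. The first [z] on the way to [v] that does not makes the sequence prime,
   together with a neighbour or a non-neighbour of [z] in [K] if necessary. *)
Lemma threshold_reach k n : exists M, forall G (K : {set G}) zs v (ps : seq (G * G)),
  size zs <= k -> M <= size ps -> pairwise (@nested G) ps -> all (fun p => edge p.1 p.2) ps ->
  (forall u p, u \in K -> p \in ps -> edge u p.1 /\ ~~ edge u p.2) ->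
  reach K zs -> v \in zs -> (forall p, p \in ps -> edge v p.2) -> contains_family n G.
Proof.
elim: k => [|k [M ih]]; first by exists 0 => G K [].
(* The four possible adjacencies of [z] to a pair leave a large uniform class: [M] pairs for the
   induction, [n.+1] for a pattern that uses neighbouring pairs. *)
exists (4 * maxn M n.+1).+1 => G K [//|z zs] v ps /= szz szp thp edp Kp /and3P[zK sz rz] vz vp.
pose col (p : G * G) := (edge z p.1, edge z p.2).
have [|[a b]] := @pigeonhole_count _ _ col (maxn M n.+1) ps; first by rewrite card_prod card_bool.
rewrite -size_filter; set qs := [seq p <- ps | _] => hq.
have hM : M <= size qs := leq_trans (leq_maxl _ _) (ltnW hq).
have hn : n.+1 < size qs := leq_ltn_trans (leq_maxr _ _) hq.
have qsub p : p \in qs -> p \in ps by rewrite mem_filter => /andP[].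
have zq p : p \in qs -> edge z p.1 = a /\ edge z p.2 = b.
  by rewrite mem_filter => /andP[/eqP[-> ->]].
have thq : pairwise (@nested G) qs by apply: subseq_pairwise thp; apply: filter_subseq.
have edq : all (fun p => edge p.1 p.2) qs by apply/allP => p /qsub; apply: (allP edp).
have [/= c [d [cK dK zc zd]]] := splitsP _ _ sz.
pose A i := (nth (z, z) qs i).1; pose B i := (nth (z, z) qs i).2.
have inq i : i < n.+1 -> nth (z, z) qs i \in qs by move=> hi; apply: mem_nth; apply: leq_trans hi (ltnW hn).
have hth i j : i < j -> j < n.+1 ->
    [/\ edge (A i) (A j), edge (A i) (B j), edge (B i) (A j) = false & edge (B i) (B j) = false].
  move=> ij jn; have := pairwise_nth (z, z) thq ij (leq_trans jn (ltnW hn)).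
  by case/and4P => ? ? /negPf ? /negPf ?.
have hAB i : i < n.+1 -> edge (A i) (B i) by move=> hi; apply: (allP edq); apply: inq.
have hK u i : u \in K -> i < n.+1 -> edge u (A i) /\ edge u (B i) = false.
  by move=> uK /inq/qsub/(Kp u _ uK)[? /negPf ?].
have hz i : i < n.+1 -> edge z (A i) = a /\ edge z (B i) = b by move/inq/zq.
clearbody qs; case: a b zq hz {hq} => [] [] zq hz.
- apply: (@realize _ (2, [:: (0, 2); (0, 3); (1, 3); (3, 3); (3, 2)], false) n
    (fun i => if i is 0 then z else d) B (fun i => A i.+1)) => //=.
  + by case=> [|[|?]] [|[|?]] // _ _; rewrite (negbTE zd).
  + case=> [|[|//]] i _ hi; first by have [_ ->] := hz i (leqW hi); have [-> _] := hz i.+1 hi.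
    by case: (hK d i.+1 dK hi) (hK d i dK (leqW hi)) => -> _ [_ ->].
  + move=> i j ij jn; have [_ _ h3 h4] := hth i j.+1 (leqW ij) jn.
    have [h1 _ _ h5] := hth i.+1 j.+1 ij jn; have [_ _ h6 h7] := hth i j ij (leqW jn).
    split=> //; move: ij; rewrite leq_eqVlt => /orP[/eqP e|lt].
      by rewrite e hAB // leqW.
    by case: (hth i.+1 j lt (leqW jn)).
  + by move=> i hi; case: (hth i i.+1 (ltnSn i) hi).
(* Here [z] sees the sequence as [K] does and joins [K]; it is not [v], which sees the second
   vertices. *)
- apply: (ih G (z |: K) zs v qs) => //.
  + move=> u p; rewrite in_setU1 => /orP[/eqP -> /zq[-> ->] //|uK /qsub]; exact: Kp.
  + move: vz; rewrite inE => /orP[/eqP evz|//].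
    have p0 := inq 0 isT; have [_] := zq _ p0.
    by have := vp _ (qsub _ p0); rewrite evz => ->.
  + by move=> p /qsub/vp.
- apply: (@realize _ (1, [:: (0, 2); (1, 1); (1, 2)], true) n (fun=> z) A B) => //=.
  + by case=> [|?] [|?].
  + by case=> [|//] i _ /leqW/hz.
  + by move=> i j ij /leqW/(hth i j ij)[-> -> -> ->].
  + by move=> i /leqW/hAB.
apply: (@realize _ (2, [:: (0, 1); (1, 2); (2, 2); (2, 3)], true) n
  (fun i => if i is 0 then z else c) A B) => //=.
- by case=> [|[|?]] [|[|?]].
- by case=> [|[|//]] i _ /leqW; [apply: hz | move=> hi; case: (hK c i cK hi) => -> ->].
- by move=> i j ij /leqW/(hth i j ij)[-> -> -> ->].
- by move=> i /leqW/hAB.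
Qed.

Definition anticomplete G (B C : {set G}) : bool :=
  [forall a in B, forall b in C, ~~ edge a b].

(** Connectedness by cuts: every cut of [B] is crossed by an edge, as needed in [connected_splits]
    for the cut into neighbours and non-neighbours of [z]. *)
Definition connected_set G (B : {set G}) := forall X : {set G},
  (exists2 a, a \in B & a \in X) -> (exists2 a, a \in B & a \notin X) ->
  exists a b, [/\ a \in B :&: X, b \in B :\: X & edge a b].

Lemma anticompleteE G (B C : {set G}) a b : anticomplete B C -> a \in B -> b \in C ->
  edge a b = false.
Proof. by move=> /forallP/(_ a)/implyP h /h/forallP/(_ b)/implyP{}h /h/negbTE. Qed.

Lemma connected_edge G (a b : G) : edge a b -> connected_set [set a; b].
Proof.
move=> ab X [u uB uX] [v vB vX].
have uv : u != v by apply: contraNneq vX => <-.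
exists u, v; rewrite in_setI in_setD uB vB uX vX; split=> //.
move: uB vB uv; rewrite !inE => /orP[]/eqP-> /orP[]/eqP->; rewrite ?eqxx // => _.
by rewrite edge_sym.
Qed.

Lemma connected_setU1 G (B : {set G}) z u : u \in B -> edge z u -> connected_set B ->
  connected_set (z |: B).
Proof.
move=> uB zu cB X [a aB aX] [b bB bX].
have lift : (exists2 a, a \in B & a \in X) -> (exists2 a, a \in B & a \notin X) ->
    exists a b, [/\ a \in (z |: B) :&: X, b \in (z |: B) :\: X & edge a b].
  move=> h1 h2; have [c [d [cX dX cd]]] := cB X h1 h2.
  by exists c, d; move: cX dX; rewrite !inE => /andP[-> ->] /andP[-> ->]; rewrite !orbT.
move: aB bB; rewrite !in_setU1 => /orP[/eqP ea|aB] /orP[/eqP eb|bB].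
- by move: bX; rewrite eb -ea aX.
- case uX: (u \in X); first by apply: lift; [exists u | exists b].
  by exists z, u; rewrite !inE -ea aX uX uB eqxx ea zu orbT.
- case uX: (u \in X); last by apply: lift; [exists a | exists u; rewrite ?uX].
  by exists u, z; rewrite !inE -eb bX uX uB eqxx eb edge_sym zu orbT.
- by apply: lift; [exists a | exists b].
Qed.

Lemma connected_neighbour G (B : {set G}) u : connected_set B -> 1 < #|B| -> u \in B ->
  exists2 v, v \in B & edge u v.
Proof.
move=> cB B1 uB; have [v vB ne] : exists2 v, v \in B & v != u.
  have /card_gt1P[a [b [aB bB ab]]] := B1.
  by case: (eqVneq a u) => [e|]; [exists b; rewrite // -e eq_sym | exists a].
have [||x [y [xB yB xy]]] := cB [set u]; [by exists u; rewrite ?inE |by exists v; rewrite ?inE|].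
by move: xB yB; rewrite !inE => /andP[_ /eqP <-] /andP[_ yB]; exists y.
Qed.

Lemma connected_splits G (B : {set G}) z : connected_set B -> splits z B ->
  exists p : G * G, [&& p.1 \in B, p.2 \in B, edge z p.1, ~~ edge z p.2 & edge p.1 p.2].
Proof.
move=> cB /splitsP[a [b [aB bB za zb]]].
have [||x [y [xB yB xy]]] := cB [set u | edge z u].
- by exists a; rewrite ?inE.
- by exists b; rewrite ?inE.
by exists (x, y); move: xB yB; rewrite !inE /= => /andP[-> ->] /andP[-> ->].
Qed.


Lemma realize_star G n z (A B : nat -> G) : (forall i, i < n -> edge z (A i)) ->
  (forall i, i < n -> edge z (B i) = false) -> (forall i, i < n -> edge (A i) (B i)) ->
  (forall i j, i < j -> j < n ->
    [/\ edge (A i) (A j) = false, edge (A i) (B j) = false,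
        edge (B i) (A j) = false & edge (B i) (B j) = false]) ->
  contains_family n G.
Proof.
move=> zA zB AB h; apply: (@realize _ (1, [:: (0, 1)], true) n (fun=> z) A B) => //=.
+ by case=> [|?] [|?].
+ by case=> [|//] i _ hi; rewrite zA ?zB.
Qed.

(** The first component is the connected set collected so far, the second the rest of the way to
    [v]. *)
Record block G v (k : nat) (b : {set G} * seq G) : Prop := Block {
  block_size : size b.2 <= k;
  block_connected : connected_set b.1;
  block_card : 1 < #|b.1|;
  block_reach : reach b.1 b.2;
  block_target : (v \in b.1) || (v \in b.2) }.

(* If the first vertices on the ways from the blocks to [v] do not yet give a prime pattern,
   they can be added to the blocks. Since [v] cannot belong to two anticomplete blocks, this
   ends. *)
Lemma blocks_reach k n : exists M, forall G v (bs : seq ({set G} * seq G)), M <= size bs ->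
  (forall b, b \in bs -> block v k b) -> pairwise (fun b c => anticomplete b.1 c.1) bs ->
  contains_family n G \/ threshold n G.
Proof.
(* When both ways are used up, [v] lies in both blocks and has a neighbour in the second. *)
have nilF G v k' (b c : {set G} * seq G) : block v k' b -> block v k' c -> b.2 = [::] ->
    c.2 = [::] -> ~~ anticomplete b.1 c.1.
  move=> hb hc eb ec; have := block_target hb; have := block_target hc.
  rewrite eb ec !orbF => vc vb; apply/negP => bc.
  have [w wc vw] := connected_neighbour (block_connected hc) (block_card hc) vc.
  by rewrite (anticompleteE bc vb wc) in vw.
elim: k => [|k [M ih]].
  exists 2 => G v [|b [|c bs]] // _ hbs /= /andP[/andP[bc _] _].
  have hb : block v 0 b by apply: hbs; rewrite mem_head.
  have hc : block v 0 c by apply: hbs; rewrite !inE eqxx orbT.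
  have nil0 (d : {set G} * seq G) : block v 0 d -> d.2 = [::].
    by move/block_size; rewrite leqn0 => /nilP.
  by have := nilF _ _ _ _ _ hb hc (nil0 _ hb) (nil0 _ hc); rewrite bc.
pose m := maxn M n.+1.
have [N hN] := ramsey (true, true, true, true, true, true) m.+2.
exists N => G v bs hsz hbs abs.
pose hd (b : {set G} * seq G) := head v b.2.
pose full z (B : {set G}) := [forall u in B, edge z u].
pose none z (B : {set G}) := [forall u in B, ~~ edge z u].
(* The colour records whether the way is empty, whether each head is complete or anticomplete to the
   other block, and whether the heads are adjacent. *)
have [t [[[[[[nl ij1] ij0] ji1] ji0] e] [tbs szt pt]]] := hN _ (fun b c : {set G} * seq G =>
  (nilp b.2, full (hd b) c.1, none (hd b) c.1, full (hd c) b.1, none (hd c) b.1,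
   edge (hd b) (hd c))) bs hsz.
pose b0 : {set G} * seq G := (set0, [::]).
pose bl i := nth b0 t i; pose B i := (bl i).1; pose z i := hd (bl i).
have hbl i : i < m.+2 -> block v k.+1 (bl i).
  by move=> hi; apply: hbs; apply: (mem_subseq tbs); apply: mem_nth; rewrite szt.
have hab i j : i < j -> j < m.+2 -> anticomplete (B i) (B j).
  move=> ij jm; apply: (pairwise_nth b0 (r := fun b c => anticomplete b.1 c.1)) => //.
    exact: subseq_pairwise tbs abs.
  by rewrite szt.
have hcol i j : i < j -> j < m.+2 -> [/\ nilp (bl i).2 = nl, full (z i) (B j) = ij1,
    none (z i) (B j) = ij0 & full (z j) (B i) = ji1] /\
    none (z j) (B i) = ji0 /\ edge (z i) (z j) = e.
  by move=> ij jm; have := pairwise_nth b0 pt ij; rewrite szt => /(_ jm) /eqP[*].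
clear pt; case: nl hcol => hcol.
  have [[/nilP h0 _ _ _] _] := hcol 0 1 isT isT;
  have [[/nilP h1 _ _ _] _] := hcol 1 m.+1 ltac:(lia) ltac:(lia).
  by have := nilF _ _ _ _ _ (hbl 0 isT) (hbl 1 isT) h0 h1; rewrite hab.
have hz i : i < m.+1 -> exists zs, (bl i).2 = z i :: zs.
  move=> hi; have [[+ _ _ _] _] := hcol i i.+1 (ltnSn i) hi.
  by rewrite /z /hd; case: (bl i).2 => // x zs _; exists zs.
have zB i : i < m.+1 -> z i \notin B i /\ splits (z i) (B i).
  by move=> hi; have := block_reach (hbl i (leqW hi)); have [zs ->] := hz i hi => /and3P[].
have spl x C : ~~ full x C -> ~~ none x C -> splits x C.
  rewrite !negb_forall => /existsP[a]; rewrite negb_imply => /andP[aC xa].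
  case/existsP=> b; rewrite negb_imply negbK => /andP[bC xb].
  by apply/splitsP; exists b, a.
(* A vertex splitting [n] blocks splits an edge in each of them: a subdivided star. *)
have star (x : G) (idx : nat -> nat) : (forall i j, i < j -> idx i < idx j) ->
    (forall i, i < n -> idx i < m.+2 /\ splits x (B (idx i))) -> contains_family n G.
  move=> mono hx.
  pose pr i := odflt (x, x) [pick p : G * G | [&& p.1 \in B (idx i), p.2 \in B (idx i),
    edge x p.1, ~~ edge x p.2 & edge p.1 p.2]].
  have hpr i : i < n -> [&& (pr i).1 \in B (idx i), (pr i).2 \in B (idx i),
      edge x (pr i).1, ~~ edge x (pr i).2 & edge (pr i).1 (pr i).2].
    move=> hi; have [im sx] := hx i hi.
    have [p hp] := connected_splits (block_connected (hbl _ im)) sx.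
    by rewrite /pr; case: pickP => [q //|/(_ p)]; rewrite hp.
  apply: (@realize_star G n x (fun i => (pr i).1) (fun i => (pr i).2)).
  - by move=> i /hpr/and5P[].
  - by move=> i /hpr/and5P[_ _ _ /negbTE].
  - by move=> i /hpr/and5P[].
  move=> i j ij jn; have hi := ltn_trans ij jn.
  have [im _] := hx i hi; have [jm _] := hx j jn.
  have /and5P[? ? _ _ _] := hpr i hi; have /and5P[? ? _ _ _] := hpr j jn.
  by split; apply: (anticompleteE (hab (idx i) (idx j) (mono _ _ ij) jm)).
have nm : n < m by rewrite /m; lia.
(* Heads that are not uniform on later blocks make [z 0] split blocks 1 to [n]; if not on earlier
   ones, [z m] splits blocks 0 to [n - 1]. *)
case: (boolP (ij1 || ij0)) => [hij|]; last first.
  rewrite negb_or => /andP[n1 n0]; left; apply: (star (z 0) succn) => // i hi.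
  have im : i.+1 < m.+2 by lia.
  have [[_ h1 h2 _] _] := hcol 0 i.+1 isT im; split=> //.
  by apply: spl; rewrite ?h1 ?h2.
case: (boolP (ji1 || ji0)) => [hji|]; last first.
  rewrite negb_or => /andP[n1 n0]; left; apply: (star (z m) id) => // i hi.
  have im : i < m by lia.
  have [[_ _ _ h1] [h2 _]] := hcol i m im (leqW (ltnSn m)); split; first by lia.
  by apply: spl; rewrite ?h1 ?h2.
pose u i := odflt v [pick x in B i | edge (z i) x].
pose u' i := odflt v [pick x in B i | ~~ edge (z i) x].
have hu i : i < m.+1 -> u i \in B i /\ edge (z i) (u i).
  move=> hi; have [_ /splitsP[a [_ [aB _ za _]]]] := zB i hi.
  by rewrite /u; case: pickP => [x /andP[]//|/(_ a)]; rewrite aB za.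
have hu' i : i < m.+1 -> u' i \in B i /\ edge (z i) (u' i) = false.
  move=> hi; have [_ /splitsP[_ [a [_ aB _ za]]]] := zB i hi.
  by rewrite /u'; case: pickP => [x /andP[? /negbTE]//|/(_ a)]; rewrite aB za.
(* [dij] and [dji] are the constant adjacencies between [z i] and [B j], [z j] and [B i]. *)
have [dij hdij] : exists d, forall i j x, i < j -> j < m.+2 -> x \in B j -> edge (z i) x = d.
  case: ij1 hij hcol => [_|/= h] hcol; [exists true | exists false] => i j x ij jm xB.
    have [[_ /forallP/(_ x) + _ _] _] := hcol i j ij jm; by rewrite xB.
  have [[_ _ + _] _] := hcol i j ij jm; rewrite h => /forallP/(_ x); rewrite xB.
  exact: negbTE.
have [dji hdji] : exists d, forall i j x, i < j -> j < m.+2 -> x \in B i -> edge (z j) x = d.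
  case: ji1 hji hcol => [_|/= h] hcol; [exists true | exists false] => i j x ij jm xB.
    have [[_ _ _ /forallP/(_ x) +] _] := hcol i j ij jm; by rewrite xB.
  have [_ [+ _]] := hcol i j ij jm; rewrite h => /forallP/(_ x); rewrite xB.
  exact: negbTE.
have he i j : i < j -> j < m.+2 -> edge (z i) (z j) = e.
  by move=> ij jm; have [_ [_ ->]] := hcol i j ij jm.
have hBB i j x y : i < j -> j < m.+2 -> x \in B i -> y \in B j -> edge x y = false.
  by move=> ij jm; apply: anticompleteE; apply: hab.
clear hcol hij hji star spl.
have huB i : i < n -> u i \in B i by move=> hi; case: (hu i) => //; lia.
have hu'B i : i < n -> u' i \in B i by move=> hi; case: (hu' i) => //; lia.
have huz i : i < n -> edge (z i) (u i) by move=> hi; case: (hu i) => //; lia.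
have hu'z i : i < n -> edge (z i) (u' i) = false by move=> hi; case: (hu' i) => //; lia.
have lt2 j : j < n -> j < m.+2 by lia.
case: dij dji e hdij hdji he => [] [] [] hdij hdji he.
- left; apply: (@realize0 _ n [:: (1, 1); (0, 1); (1, 0)] false u' z) => // [i j ij jn|i hi].
    have [hi jm] := (ltn_trans ij jn, lt2 j jn).
    by rewrite (hBB i j (u' i) (u' j)) ?hu'B // edge_sym (hdji i j (u' i)) ?hu'B //
      (hdij i j (u' j)) ?hu'B // he.
  by rewrite edge_sym hu'z.
- left; apply: (@realize0 _ n [:: (0, 1); (1, 0)] false u' z) => // [i j ij jn|i hi].
    have [hi jm] := (ltn_trans ij jn, lt2 j jn).
    by rewrite (hBB i j (u' i) (u' j)) ?hu'B // edge_sym (hdji i j (u' i)) ?hu'B //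
      (hdij i j (u' j)) ?hu'B // he.
  by rewrite edge_sym hu'z.
- right; exists z, u; split=> // i j ij jn; have [hi jm] := (ltn_trans ij jn, lt2 j jn).
  by rewrite (hBB i j (u i) (u j)) ?huB // [edge (u i) (z j)]edge_sym (hdji i j (u i)) ?huB //
    (hdij i j (u j)) ?huB // he.
- left; apply: (@realize0 _ n [:: (0, 1)] true z u) => // i j ij jn.
  have [hi jm] := (ltn_trans ij jn, lt2 j jn).
  by rewrite (hBB i j (u i) (u j)) ?huB // [edge (u i) (z j)]edge_sym (hdji i j (u i)) ?huB //
    (hdij i j (u j)) ?huB // he.
(* Here [z j] sees [u i] exactly for [i <= j], so the order is reversed. *)
- right; exists (fun i => z (n.-1 - i)), (fun i => u (n.-1 - i)).
  split=> [i hi|i j ij jn]; first by apply: huz; lia.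
  have ji : n.-1 - j < n.-1 - i by lia.
  have [hi hj im] : [/\ n.-1 - i < n, n.-1 - j < n & n.-1 - i < m.+2] by split; lia.
  rewrite [edge (z _) (z _)]edge_sym he // [edge (u _) (z _)]edge_sym.
  rewrite (hdij (n.-1 - j) (n.-1 - i) (u (n.-1 - i))) ?huB //.
  rewrite (hdji (n.-1 - j) (n.-1 - i) (u (n.-1 - j))) ?huB // [edge (u _) (u _)]edge_sym.
  by rewrite (hBB (n.-1 - j) (n.-1 - i) (u (n.-1 - j)) (u (n.-1 - i))) ?huB.
- left; apply: (@realize0 _ n [:: (0, 1)] true u z) => // [i j ij jn|i hi].
    have [hi jm] := (ltn_trans ij jn, lt2 j jn).
    by rewrite (hBB i j (u i) (u j)) ?huB // edge_sym (hdji i j (u i)) ?huB //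
    (hdij i j (u j)) ?huB // he.
  by rewrite edge_sym huz.
- left; apply: (@realize0 _ n [:: (1, 1)] true u z) => // [i j ij jn|i hi].
    have [hi jm] := (ltn_trans ij jn, lt2 j jn).
    by rewrite (hBB i j (u i) (u j)) ?huB // edge_sym (hdji i j (u i)) ?huB //
    (hdij i j (u j)) ?huB // he.
  by rewrite edge_sym huz.
(* No head sees another block or head, so the blocks enlarged by their heads stay anticomplete, with
   shorter ways. *)
apply: (ih G v (mkseq (fun i => (z i |: B i, behead (bl i).2)) m)).
- by rewrite size_mkseq leq_maxl.
- move=> b /mapP[i]; rewrite mem_iota add0n => /= im ->.
  have [zs ezs] := hz i (leqW im); have hb := hbl i (leqW (leqW im)).
  have [zi_uB zi_u] := hu i (leqW im).
  have [zN _] := zB i (leqW im).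
  split=> /=.
  + by have := block_size hb; rewrite ezs.
  + exact: connected_setU1 zi_uB zi_u (block_connected hb).
  + by rewrite cardsU1 zN (leq_trans (block_card hb)) // leq_addl.
  + by have := block_reach hb; rewrite ezs => /and3P[].
  + have := block_target hb; rewrite ezs !inE /= -/(B i).
    by rewrite orbCA orbA.
apply: pairwise_mkseq => i j ij jm /=; have im := ltn_trans ij jm.
have jm2 : j < m.+2 by apply: leqW; apply: leqW.
apply/forallP => a; apply/implyP; rewrite in_setU1 => aB.
apply/forallP => c; apply/implyP; rewrite in_setU1 => cB; apply/negbT.
move: aB cB => /orP[/eqP->|aB] /orP[/eqP->|cB].
- exact: he.
- exact: hdij cB.
- by rewrite edge_sym; apply: hdji aB.
- exact: hBB aB cB.
Qed.

End Unavoidable.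

(** * The unavoidability theorem *)

Lemma reach_co (G : sgraph) (B : {set G}) zs : @reach (co G) B zs = reach B zs.
Proof.
elim: zs B => //= z zs ih B; case zB: (z \in B) => //=; rewrite ih; congr (_ && _).
have hz x : x \in B -> @edge (co G) z x = ~~ edge z x.
  by move=> xB; rewrite co_edgeE //; apply: contraFneq zB => ->.
apply/splitsP/splitsP => -[a [b [aB bB za zb]]]; exists b, a; split=> //.
- by move: zb; rewrite hz // negbK.
- by move: za; rewrite hz.
- by rewrite hz.
- by rewrite hz // negbK.
Qed.

Lemma separable_co (G : sgraph) t : separable G t -> separable (co G) t.
Proof.
move=> h a b v ne; have [zs [sz rz vz]] := h a b v ne.
by exists zs; rewrite reach_co.
Qed.

(** The way leads from the last pair to [A 0]. Both vertices of the last pair see only the clique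
    side of the pairs in between, whereas [A 0] also sees their stable side. *)
Lemma threshold_separable t n : exists M, forall G, separable G t -> threshold M G ->
  contains_family n G.
Proof.
have [M hM] := threshold_reach t n.
exists M.+2 => G sG [A [B [hAB h]]].
have [last_adj _ hBA _] := h 0 M.+1 isT (ltnSn _).
have AB : A M.+1 != B M.+1.
  by apply/eqP => e; have := hAB M.+1 (ltnSn _); rewrite e edge_irrefl.
have [zs [szz rz vz]] := sG _ _ (A 0) AB.
apply: (hM G _ zs (A 0) (mkseq (fun i => (A i.+1, B i.+1)) M)) rz _ _ => //.
- by rewrite size_mkseq.
- apply: pairwise_mkseq => i j ij jM; rewrite /nested /=.
  by have [-> -> -> ->] := h i.+1 j.+1 ij ltac:(lia).
- by apply/allP => p /mapP[i]; rewrite mem_iota => hi -> /=; apply: hAB; lia.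
- move=> u p uT /mapP[i]; rewrite mem_iota => hi -> /=.
  have [h1 h2 h3 h4] := h i.+1 M.+1 ltac:(lia) ltac:(lia).
  by move: uT; rewrite !inE => /orP[]/eqP ->; rewrite ![edge (_ M.+1) _]edge_sym ?h1 ?h2 ?h3 ?h4.
- case/orP: vz => //; rewrite !inE; have [h1 h2 _ _] := h 0 M.+1 isT (ltnSn _).
  by case/orP => /eqP e; move: h1 h2; rewrite -e edge_irrefl.
by move=> p /mapP[i]; rewrite mem_iota => hi -> /=; case: (h 0 i.+1 isT ltac:(lia)).
Qed.

(** Each matching edge starts a block, and all ways lead to the common target [A 0]. *)
Lemma matching_separable t n : exists M, forall G, separable G t -> matching M G ->
  contains_family n G \/ threshold n G.
Proof.
have [M hM] := blocks_reach t n.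
exists M.+1 => G sG [A [B [hAB h]]]; pose v := A 0.
have hzs i : exists zs, i < M.+1 -> block v t ([set A i; B i], zs).
  case: (ltnP i M.+1) => [hi|_]; last by exists [::].
  have ne : A i != B i by apply/eqP => e; have := hAB i hi; rewrite e edge_irrefl.
  have [zs [szz rz vz]] := sG _ _ v ne; exists zs => _; split=> //=.
    exact: connected_edge (hAB i hi).
  by rewrite cards2 ne.
have /fin_all_exists[zs hzs'] (i : 'I_M.+1) : exists zs, block v t ([set A i; B i], zs).
  by have [zs hz] := hzs i; exists zs; apply: hz.
apply: (hM G v [seq ([set A i; B i], zs i) | i : 'I_M.+1 <- enum 'I_M.+1]).
- by rewrite size_map size_enum_ord.
- by move=> b /mapP[i _ ->].
rewrite pairwise_map.
have : pairwise (fun i j : 'I_M.+1 => i < j) (enum 'I_M.+1).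
  by rewrite -(pairwise_map (fun i : 'I_M.+1 => i : nat) ltn) val_enum_ord
    -(sorted_pairwise ltn_trans) iota_ltn_sorted.
apply: sub_pairwise => i j ij /=.
have [h1 h2 h3 h4] := h i j ij (ltn_ord j).
apply/forallP => a; apply/implyP => aB; apply/forallP => b; apply/implyP => bB.
by move: aB bB; rewrite !inE => /orP[]/eqP -> /orP[]/eqP ->; rewrite ?h1 ?h2 ?h3 ?h4.
Qed.

Lemma matching_leq m n G : m <= n -> matching n G -> matching m G.
Proof.
move=> mn [A [B [hAB h]]]; exists A, B; split=> [i hi|i j ij jm].
  by apply: hAB; apply: leq_trans mn.
by apply: h => //; apply: leq_trans mn.
Qed.

Lemma threshold_leq m n G : m <= n -> threshold n G -> threshold m G.
Proof.
move=> mn [A [B [hAB h]]]; exists A, B; split=> [i hi|i j ij jm].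
  by apply: hAB; apply: leq_trans mn.
by apply: h => //; apply: leq_trans mn.
Qed.

Lemma unavoidable_families t n : 3 <= n -> exists M, forall G, prime_graph G ->
  separable G t -> M <= #|G| -> contains_family n G.
Proof.
(* The bounds are chosen backwards: for threshold graphs, for matchings, for stable sets, and
   finally for Ramsey's theorem. *)
move=> n3; have [a ha] := threshold_separable t n.
have [b hb] := matching_separable t (maxn n a).
have [c hc] := stable_patterns (maxn b (maxn n a)).
have [M hM] := ramsey true c.
have stable (G : sgraph) (s : seq G) : prime_graph G -> separable G t -> 2 < #|G| -> uniq s ->
    pairwise (fun x y => ~~ edge x y) s -> c <= size s -> contains_family n G.
  move=> pG sG G2 us st cs.
  have thr : threshold (maxn n a) G -> contains_family n G.
    by move/(threshold_leq (leq_maxr _ _)); apply: ha.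
  case: (hc G s pG G2 us st cs) => [h|h|h].
  - by apply: contains_family_leq h; lia.
  - case: (hb G sG (matching_leq (leq_maxl _ _) h)) => [|/thr//].
    by apply: contains_family_leq; lia.
  - by apply: thr; apply: threshold_leq h; lia.
exists (maxn 3 M) => G pG sG; rewrite geq_max => /andP[G3 GM].
have [|s [e [sub szs pe]]] := hM G (fun x y => edge x y) (enum G); first by rewrite -cardE.
have us : uniq s := subseq_uniq sub (enum_uniq _).
case: e pe => pe; last first.
  apply: (stable G s) => //; rewrite ?szs //.
  by apply: sub_pairwise pe => x y /eqP ->.
apply: contains_family_co => //.
apply: (stable (co G) s) => //; rewrite ?szs //; [exact: prime_co | exact: separable_co|].
by apply: sub_pairwise pe => x y /eqP xy; rewrite /edge /= /co_edge negb_and xy orbT.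
Qed.

(** * Words in large prime graphs and the decision procedure *)

Definition contains_word A w N (G : sgraph) := exists f : nat -> G,
  (forall i j, i <= N -> j <= N -> f i = f j -> i = j) /\
  forall i j, i <= N -> j <= N -> edge (f i) (f j) = wadj A w i j.

Lemma contains_wordP A w N (G : sgraph) (f : nat -> G) :
  (forall i j, i < j -> j <= N -> f i != f j) ->
  (forall i j, i < j -> j <= N -> edge (f i) (f j) = wadj A w i j) -> contains_word A w N G.
Proof.
move=> fi fe; exists f; split=> i j iN jN.
  move=> e; case: (ltngtP i j) => // lt.
    by have := fi i j lt jN; rewrite e eqxx.
  by have := fi j i lt iN; rewrite e eqxx.
case: (ltngtP i j) => [lt|lt|->]; first exact: fe.
  by rewrite edge_sym wadj_sym fe.
by rewrite edge_irrefl wadj_irr.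
Qed.

Lemma fam_word_walk F b N : walk (fam_system F b) N (fam_word F.1.1).
Proof.
apply/walkP; case: F => [[r D] s]; split=> [|i _] /=.
  by rewrite /fam_word; case: posnP => // ->.
change ((fam_word r i, fam_word r i.+1) \in (r.+1, r) :: [seq (i, i.+1) | i <- iota 0 r.+1]).
have mem k : k <= r -> (k, k.+1) \in [seq (i, i.+1) | i <- iota 0 r.+1].
  by move=> kr; apply: (map_f (fun i => (i, i.+1))); rewrite mem_iota.
rewrite in_cons /fam_word; case: (ltnP i r) => ir.
  have -> : (if i.+1 < r then i.+1 else r + odd (i.+1 - r)) = i.+1.
    by case: ltnP => // h; have -> : i.+1 - r = 0; [lia | rewrite addn0; lia].
  by rewrite mem ?orbT // ltnW.
rewrite ltnNge leqW //= subSn //=.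
by case: (odd (i - r)); rewrite /= ?addn0 ?addn1 ?eqxx // mem ?orbT.
Qed.

Lemma unavoidable_words N : exists M, forall G, prime_graph G -> M <= #|G| ->
  exists A w, is_system A /\ walk A N w /\ contains_word A w N G.
Proof.
(* [N + 3] blocks provide the positions up to [N] and the three blocks required for primality. *)
have [M hM] := @unavoidable_families N (N + 3) ltac:(lia).
exists M => G pG GM; case: (chain_or_separable N pG) => [[w [f [w0 w2 fi fe]]]|sG].
  exists chain_system, w; split; [by left | split].
    apply/walkP; split=> // i _.
    by case: (w i) (w2 i) => [|[|//]] _; case: (w i.+1) (w2 i.+1) => [|[|//]].
  apply: (contains_wordP _ fe) => i j ij jN; apply/eqP => e.
  have iN : i < N.+1 := ltn_trans ij (jN : j < N.+1).
  by have /(congr1 val)/= := fi (Ordinal iN) (Ordinal (jN : j < N.+1)) e; lia.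
have [F [b [hF [f hf]]]] := hM G pG sG GM.
exists (fam_system F b), (fam_word F.1.1); split; first by right; exists F, b.
split; first exact: fam_word_walk.
have h3 : 3 <= N + 3 by lia.
apply: (contains_wordP (f := f)) => i j ij jN; last by apply: hf => //; lia.
apply: (prime_word_inj _ (families_prime (b := b) hF h3) hf) => //; lia.
Qed.

(* There are finitely many adjacency matrices of size less than [n]. *)
Lemma infinitely_many_large (C : sgraph -> Prop) n : infinitely_many_up_to_iso C ->
  exists G, C G /\ n <= #|G|.
Proof.
move=> [F [hC hF]].
(* The order and the adjacency matrix padded to size [n]; they determine a graph of order below [n]
   up to isomorphism. *)
pose code (G : sgraph) : 'I_n.+1 * {ffun 'I_n * 'I_n -> bool} :=
  (inord #|G|, [ffun p : 'I_n * 'I_n => [exists x : G, exists y : G,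
     [&& edge x y, enum_rank x == p.1 :> nat & enum_rank y == p.2 :> nat]]]).
have codeP (G H : sgraph) : #|G| < n -> #|H| < n -> code G = code H -> iso G H.
  move=> hG hH [/(congr1 val) /=]; rewrite !inordK ?ltnS 1?ltnW // => eGH /ffunP ecode.
  pose f (x : G) : H := enum_val (cast_ord eGH (enum_rank x)).
  have fr (x : G) : enum_rank (f x) = enum_rank x :> nat by rewrite enum_valK.
  have rk (K : sgraph) (hK : #|K| < n) (x y : K) : edge x y =
      (code K).2 (widen_ord (ltnW hK) (enum_rank x), widen_ord (ltnW hK) (enum_rank y)).
    rewrite ffunE /=; apply/idP/existsP => [xy|[x' /existsP[y' /and3P[xy]]]].
      by exists x; apply/existsP; exists y; rewrite xy !eqxx.
    by move=> /eqP/val_inj/enum_rank_inj <- /eqP/val_inj/enum_rank_inj <-.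
  exists f.
    exists (fun y => enum_val (cast_ord (esym eGH) (enum_rank y))) => x.
      by rewrite enum_valK cast_ordK enum_rankK.
    by rewrite /f enum_valK cast_ordKV enum_rankK.
  move=> x y; rewrite (rk _ hG) (rk _ hH) /code /= ecode; congr (_ _).
  by congr (_, _); apply: val_inj; rewrite /= fr.
pose m := #|{: 'I_n.+1 * {ffun 'I_n * 'I_n -> bool}}|.
case: (boolP [exists i : 'I_m.+1, n <= #|F i|]) => [/existsP[i hi]|].
  by exists (F i).
rewrite negb_exists => /forallP small.
have : ~~ injectiveb (fun i : 'I_m.+1 => code (F i)).
  by apply/negP => /injectiveP/leq_card; rewrite card_ord ltnn.
case/injectivePn => i [j ne e]; exfalso.
apply: (hF i j); first by move/val_inj => eij; rewrite eij eqxx in ne.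
by apply: codeP e; rewrite ltnNge small.
Qed.

Lemma free_contains_word A w N (L : seq sgraph) (G : sgraph) :
  Free (fun H => List.In H L) G -> walk A N w -> contains_word A w N G -> free_walk A N L w.
Proof.
move=> free ww [f [fi fe]]; rewrite /free_walk ww /=.
have hL H : List.In H L -> ~~ occurs A w N H.
  move=> hH; apply/negP => /occursP[g [gi gN ge]]; apply: (free H hH).
  apply/induced_subgraphP; exists (f \o g); split=> [x y /= e|x y /=].
    by apply: gi; apply: fi e.
  by rewrite fe ?ge.
elim: L {free} hL => //= H L ih hL; rewrite hL /=; last by left.
by apply: ih => H' hH'; apply: hL; right.
Qed.

Theorem theorem1p1 :
  exists p : recfun 1,
    decides p (fun L : seq sgraph =>
      infinitely_many_up_to_iso (fun G : sgraph =>
        Free (fun H : sgraph => List.In H L) G /\ prime_graph G)).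
Proof.
(* The program tries each of the finitely many systems in turn. *)
have [p hp] : decidable_in (fun k : ctx 1 => has (fun A => has_free_walk A k.2) systems).
  elim: systems => [|A s ih]; first exact: computable_cst.
  exact: decidable_or (decidable_has_free_walk A) ih.
exists p => L; exists (has (fun A => has_free_walk A (encode_graphs L)) systems).
  have := hp (tt, encode_graphs L).
  by have -> : tup ((tt, encode_graphs L) : ctx 1) = [tuple encode_graphs L] by apply: val_inj.
split=> [/has_systems[A [sA]]|inf].
  case/has_free_walkP => [|w hw]; first exact: system_small_letters.
  apply: (free_walks_infinite sA); apply: pumping hw; last exact: card_state.
  exact: system_small_letters.
(* An infinite class has a prime member large enough to contain a word as long as the search
   requires; the word inherits freeness. *)
have [M hM] := unavoidable_words (walk_bound (encode_graphs L)).
have [G [[free pG] GM]] := infinitely_many_large M inf.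
have [A [w [sA [ww cw]]]] := hM G pG GM.
apply/has_systems; exists A; split=> //.
apply/has_free_walkP; first exact: system_small_letters.
by exists w; apply: free_contains_word cw.
Qed.
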